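(* Let $\theta\in(0,\infty)^V$, $\eta\in[0,\infty)^V$ and $z\in(0,\infty)^V$. On the one hand, let $(\beta_i)_{i\in V}$ be a random vector with distribution $\nu_V^{W,\theta,\eta+1/z}$, where $\eta+1/z=(\eta_i+1/z_i)_{i\in V}$. Conditionally on $\beta$, let $(\alpha_i)_{i\in V}$ be a random vector with distribution $\nu_V^{\widetilde W,\widetilde\theta,\widetilde\eta}$, where $\widetilde W=WK_{1/(2\beta)}^{-1}$, $\widetilde\eta=\eta+WH_\beta^{-1}\eta$ and $\widetilde\theta_i=\frac1{2\beta_iz_i}$ for every $i\in V$. On the other hand, let $(\delta_i)_{i\in V}$ be a random vector with distribution $\nu_V^{W,\theta,\eta}$, and let $(A_i)_{i\in V}$ be a family of independent random variables, independent of $\delta$, such that for every $i\in V$, $A_i$ has the Inverse Gaussian distribution $IG\left(\frac1{\theta_iz_i},\frac1{z_i^2}\right)$. Then $$\left((2\beta_i)_{i\in V},\left(\frac{(2\beta_i)^2}{2\alpha_i}\right)_{i\in V}\right)\overset{\text{law}}{=}\left((2\delta_i+A_i)_{i\in V},\left(A_i+\frac{A_i^2}{2\delta_i}\right)_{i\in V}\right).$$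
   Context: Let $\mathcal G=(V,E)$ be a finite, connected, non-oriented graph with conductances $(W_e)_{e\in E}\in(0,\infty)^E$; $W=(W_{i,j})_{i,j\in V}$ is the symmetric matrix with $W_{i,j}=W_{\{i,j\}}$ if $\{i,j\}\in E$ and $W_{i,j}=0$ otherwise ($W_{i,i}>0$ is allowed). A vector $x\in\mathbb R^V$ is also used to denote the diagonal matrix with diagonal entries $x_i$. For $t\in[0,\infty)^V$, $K_t=\mathrm{Id}-tW$; $1/(2\beta)$ is the vector $(1/(2\beta_i))_{i\in V}$. For $\beta\in\mathbb R^V$, $H_\beta=2\beta-W$, $|H_\beta|$ is its determinant, and $H_\beta>0$ means positive definite. For $\theta\in(0,\infty)^V$, $\eta\in[0,\infty)^V$, the probability measure $\nu_V^{W,\theta,\eta}$ on $\mathbb R^V$ is $$\nu_V^{W,\theta,\eta}(d\beta)=\mathbf 1_{H_\beta>0}\left(\tfrac2\pi\right)^{|V|/2}\exp\left(-\tfrac12\langle\theta,H_\beta\theta\rangle-\tfrac12\langle\eta,H_\beta^{-1}\eta\rangle+\langle\eta,\theta\rangle\right)\frac{\prod_{i\in V}\theta_i}{\sqrt{|H_\beta|}}\,d\beta .$$ The same formula defines $\nu_V^{\widetilde W,\widetilde\theta,\widetilde\eta}$, with $H_\beta$ replaced by $2\beta-\widetilde W$; here $\widetilde W=W+WH_\beta^{-1}W$ is symmetric with nonnegative entries. $IG(\mu,r)$, $\mu,r>0$, is the Inverse Gaussian distribution with density $\sqrt{\frac{r}{2\pi x^3}}\exp\left(-\frac{r(x-\mu)^2}{2\mu^2x}\right)\mathbf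 1_{x>0}$. *)

(* Defs.v *)
From HB Require Import structures.
From mathcomp Require Import all_boot all_order all_algebra.
From mathcomp Require Import all_classical all_reals all_analysis.

Set Implicit Arguments.
Unset Strict Implicit.
Unset Printing Implicit Defensive.
Import Order.TTheory GRing.Theory Num.Theory.
Local Open Scope classical_set_scope.
Local Open Scope ring_scope.

(* The vertex set V is 'I_n. Points of R^V that carry a law are n.-tuple R,    *)
(* which has the product sigma-algebra; parameter vectors are 'cV[R]_n.        *)

(* Lebesgue measure on R^n, as the n-fold product of lebesgue_measure:         *)
(* lebesgue_tuple_box determines it.                                           *)

Section lebesgue_tuple.
Context {R : realType}.

Definition tuple_cons n (x : n.-tuple R * measurableTypeR R) : n.+1.-tuple R :=
  [the n.+1.-tuple R of x.2 :: x.1].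

Lemma measurable_tuple_cons n : measurable_fun setT (@tuple_cons n).
Proof.
exact: (@measurable_cons _ _ (n.-tuple R * measurableTypeR R)%type R).
Qed.

Section step.
Context {n : nat} (mu : {measure set (n.-tuple R) -> \bar R}).

Definition lebesgue_tuple_step : set (n.+1.-tuple R) -> \bar R :=
  pushforward (mu \x lebesgue_measure)%E (@tuple_cons n).

Let nu := measure_function_pushforward__canonical__measure_function_Measure
  (mu \x lebesgue_measure)%E (@measurable_tuple_cons n).

HB.instance Definition _ := isMeasure.Build _ _ _ lebesgue_tuple_step
  (measure0 nu) (measure_ge0 nu) (@measure_semi_sigma_additive _ _ _ nu).

End step.

Fixpoint lebesgue_tuple n : {measure set (n.-tuple R) -> \bar R} :=
  match n with
  | 0 => \d_([tuple])
  | m.+1 => lebesgue_tuple_step (lebesgue_tuple m)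
  end.

Lemma lebesgue_tuple_box n (B : 'I_n -> set R) :
  (forall i, measurable (B i)) ->
  lebesgue_tuple n [set x | forall i, B i (tnth x i)] =
  (\prod_(i < n) (lebesgue_measure (B i) : \bar R))%E.
Proof.
elim: n B => [|n IH] B mB.
  by rewrite big_ord0 /= diracE mem_set//= => -[].
rewrite big_ord_recl /= /lebesgue_tuple_step /pushforward.
rewrite (_ : _ @^-1` _ =
   [set x | forall i, B (lift ord0 i) (tnth x i)] `*` B ord0); last first.
  apply/seteqP; split => [[x r] /= h|[x r] /= [h h0] i].
    split; last exact: (h ord0).
    by move=> i; have := h (lift ord0 i); rewrite tnthS.
  by have [j ->|->//] := unliftP ord0 i; rewrite tnthS.
rewrite product_measure1E//; last exact: (mB ord0).
  by rewrite muleC; congr (_ * _)%E; apply: (IH (fun i => B (lift ord0 i))).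
rewrite (_ : [set x | _] = \bigcap_(i in [set: 'I_n])
   ((fun x : n.-tuple R => tnth x i) @^-1` (B (lift ord0 i)))); last first.
  by apply/seteqP; split => [x h i _|x h i]; [exact: h|exact: h].
apply: fin_bigcap_measurable => // i _.
by rewrite -[X in measurable X]setTI; exact: measurable_tnth.
Qed.

End lebesgue_tuple.

Section graph.
Context {R : realType} {n : nat}.
Implicit Types (E : {set {set 'I_n}}) (c : {set 'I_n} -> R).

(* The edge {i, j} is the set [set i; j], a singleton when i = j: loops, i.e.  *)
(* W i i > 0, are allowed.                                                     *)
Definition connected_graph E : Prop :=
  [/\ (0 < n)%N,
      forall e, e \in E -> (0 < #|e| <= 2)%N &
      forall i j, connect (fun k l => [set k; l]%SET \in E) i j].

Definition conductance_mx E c : 'M[R]_n :=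
  \matrix_(i, j) if [set i; j]%SET \in E then c [set i; j]%SET else 0.

End graph.

Section nu.
Context {R : realType} {n : nat}.
Implicit Types (W H : 'M[R]_n) (theta eta u v z : 'cV[R]_n) (b : n.-tuple R).

Definition dot u v : R := (u^T *m v) 0 0.

Definition posdefmx H : Prop :=
  H^T = H /\ forall u, u != 0 -> 0 < dot u (H *m u).

Definition Hmx W b : 'M[R]_n := diag_mx (\row_i (2 * tnth b i)) - W.

(* K_t = Id - t W *)
Definition Kmx W (t : 'rV[R]_n) : 'M[R]_n := 1%:M - diag_mx t *m W.

Definition nu_pdf W theta eta b : R :=
  if `[< posdefmx (Hmx W b) >] then
    (2 / pi) `^ (n%:R / 2) *
    expR (- (2^-1 * dot theta (Hmx W b *m theta))
          - 2^-1 * dot eta (invmx (Hmx W b) *m eta)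
          + dot eta theta) *
    (\prod_i theta i 0) / Num.sqrt (\det (Hmx W b))
  else 0.

(* The law nu_V^{W, theta, eta}. That its total mass is 1 for theta > 0 and    *)
(* eta >= 0 is a theorem, not part of the definition.                          *)
Definition nu W theta eta (A : set (n.-tuple R)) : \bar R :=
  (\int[lebesgue_tuple n]_(b in A) (nu_pdf W theta eta b)%:E)%E.

(* W K_{1/(2b)}^{-1} *)
Definition Wtilde W b : 'M[R]_n :=
  W *m invmx (Kmx W (\row_i (2 * tnth b i)^-1)).

Definition eta_tilde W eta b : 'cV[R]_n :=
  eta + W *m (invmx (Hmx W b) *m eta).

Definition theta_tilde z b : 'cV[R]_n :=
  \col_i (2 * tnth b i * z i 0)^-1.

End nu.

(* The Inverse Gaussian distribution IG(mu, r). *)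
Definition ig_pdf {R : realType} (mu r x : R) : R :=
  if 0 < x then
    Num.sqrt (r / (2 * pi * x ^+ 3)) *
    expR (- (r * (x - mu) ^+ 2 / (2 * mu ^+ 2 * x)))
  else 0.

Definition ig {R : realType} (mu r : R) (A : set R) : \bar R :=
  (\int[lebesgue_measure]_(x in A) (ig_pdf mu r x)%:E)%E.

Section laws.
Local Open Scope ereal_scope.
Context {R : realType}.

Definition has_law {d d'} {T : measurableType d} {T' : measurableType d'}
    (P : probability T R) (X : {RV P >-> T'}) (mu : set T' -> \bar R) : Prop :=
  forall A, measurable A -> distribution P X A = mu A.

(* Conditionally on X, Y has law k X: k (X _) B is a version of P(Y \in B | X)  *)
(* for every B. For X, Y with values in R^n this fixes the law of (X, Y).      *)
Definition has_cond_law {d d1 d2} {T : measurableType d}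
    {T1 : measurableType d1} {T2 : measurableType d2} (P : probability T R)
    (X : {RV P >-> T1}) (Y : {RV P >-> T2}) (k : T1 -> set T2 -> \bar R) : Prop :=
  forall A B, measurable A -> measurable B ->
    P (X @^-1` A `&` Y @^-1` B) = \int[P]_(w in X @^-1` A) k (X w) B.

Definition mutually_independent {d d'} {T : measurableType d}
    {T' : measurableType d'} (P : probability T R) {I : finType}
    (X : I -> {RV P >-> T'}) : Prop :=
  forall (J : {set I}) (B : I -> set T'), (forall i, measurable (B i)) ->
    P (\bigcap_(i in [set` J]) X i @^-1` B i) = \prod_(i in J) P (X i @^-1` B i).

Definition independent {d d1 d2} {T : measurableType d}
    {T1 : measurableType d1} {T2 : measurableType d2} (P : probability T R)
    (X : T -> T1) (Y : T -> T2) : Prop :=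
  forall A B, measurable A -> measurable B ->
    P (X @^-1` A `&` Y @^-1` B) = P (X @^-1` A) * P (Y @^-1` B).

Definition eq_in_law {d1 d2 d} {T1 : measurableType d1} {T2 : measurableType d2}
    {T : measurableType d} (P : probability T1 R) (Q : probability T2 R)
    (X : T1 -> T) (Y : T2 -> T) : Prop :=
  forall A, measurable A -> pushforward P X A = pushforward Q Y A.

End laws.

Arguments has_law {R d d' T T'} P X mu.
Arguments has_cond_law {R d d1 d2 T T1 T2} P X Y k.
Arguments mutually_independent {R d d' T T'} P {I} X.

(* Main.v *)
Require Import Defs.
From HB Require Import structures.
From mathcomp Require Import all_boot all_order all_algebra.
From mathcomp Require Import all_classical all_reals all_analysis.
From mathcomp Require Import measurable_realfun.
From mathcomp Require Import ring lra.

(* Write b = 2 beta, a = 2 alpha, d = 2 delta. The two pairs of the theorem   *)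
(* coincide exactly when, in each coordinate, A = b^2/(a+b) and d = ab/(a+b), *)
(* so the claim is a change of variables between two joint densities, with    *)
(* Jacobian d(delta) dA = 2 b^2/(a+b)^2 d(beta) d(alpha).                     *)
(*   Put G = H_beta^-1 and S = 2 alpha - W~. As W~ = b G b - b, the matrices  *)
(* S and H_delta = H_beta - b (a+b)^-1 b are the two Schur complements of the *)
(* block matrix [[H_beta, b], [b, a+b]]. This matches the supports of the     *)
(* densities, gives det H_beta det S = prod_i (a_i+b_i) det H_delta, and      *)
(* yields Woodbury's formula H_delta^-1 = G + G b S^-1 b G, by which the      *)
(* exponents agree.                                                           *)
(*   The change of variables acts coordinatewise: a translation of delta by   *)
(* A/2 for fixed A, then the inversion A = b^2/(2 alpha + b) for fixed b.     *)

(** Both pairs of random vectors have a joint density on R^n x R^n: [beta_alpha_pdf] for (beta,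
    alpha) by [beta_alpha_law], and [delta_A_pdf] for (delta, A) by [delta_A_law]. The vectors of
    the theorem are their images under [PhiL] and [PhiR], and the map (x, y) |-> ([inv_delta x y],
    [inv_A x y]) turns [PhiR] into [PhiL] on the positive orthant. So it suffices that this map,
    with its Jacobian, carries one density to the other: [lebesgue_tuple_shear_inversion] is the
    change of variables, and [delta_A_pdf_inv], which rests on [nu_pdf_delta], the identity of
    densities. Both densities vanish off the positive orthant, because a positive definite matrix
    has a positive diagonal while [W] and W~ have nonnegative ones. The Inverse Gaussian factors
    supply exactly what the measures nu lack. In front of the exponential, each one times its
    Jacobian gives sqrt(2/pi) theta~_i / sqrt(a_i + b_i) ([ig_pdf_delta]); the product is the second
    normalizing constant, the product of the theta~_i, and the factor that [det_delta] asks for. In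
    the exponent, expanding the square gives - A theta^2 / 2 + theta / z - 1 / (2 z^2 A). The first
    term turns H_delta into H_beta, the second turns <eta, theta> into <eta + 1/z, theta>, and the
    third, since 1/A = (a+b)/b^2, is the diagonal part of - <theta~, S theta~> / 2. The remaining
    quadratic terms match by Woodbury's formula [invmx_delta]; this is [exponent_delta]. *)

Set Implicit Arguments.
Unset Strict Implicit.
Unset Printing Implicit Defensive.
Import Order.TTheory GRing.Theory Num.Theory.
Import numFieldNormedType.Exports.
Local Open Scope classical_set_scope.
Local Open Scope ring_scope.

(** * Measures with a density *)

Section density_measure.
Local Open Scope ereal_scope.
Context d (T : measurableType d) (R : realType).
Context (mu : {measure set T -> \bar R}) (f : T -> \bar R).

(** The proofs [mf] and [f0] are arguments so that the measure structure can be attached to this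
    name. *)
Definition density_measure (mf : measurable_fun setT f)
  (f0 : forall x, 0 <= f x) (A : set T) : \bar R := \int[mu]_(x in A) f x.

Context (mf : measurable_fun setT f) (f0 : forall x, 0 <= f x).

Local Notation dm := (density_measure mf f0).

Let dm0 : dm set0 = 0. Proof. by rewrite /density_measure integral_set0. Qed.

Let dm_ge0 A : 0 <= dm A. Proof. by apply: integral_ge0 => x _; exact: f0. Qed.

Let dm_sigma_additive : semi_sigma_additive dm.
Proof.
move=> F mF tF mbF; rewrite /density_measure ge0_integral_bigcup//.
- by apply: is_cvg_ereal_nneg_natsum => n _; exact: integral_ge0.
- exact: measurable_funS mf.
Qed.

HB.instance Definition _ := isMeasure.Build _ _ _ dm
  dm0 dm_ge0 dm_sigma_additive.

End density_measure.

(** Uniqueness of measures on a generating pi-system. As [m] is finite, the constant sequence [setT]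
    serves as the exhausting cover. *)
Lemma eq_density_measure d (T : measurableType d) (R : realType)
    (G : set (set T)) (m mu : {measure set T -> \bar R}) (f : T -> \bar R) :
  measurable = <<s G >> -> setI_closed G -> G setT -> (m setT < +oo)%E ->
  measurable_fun setT f -> (forall x, (0 <= f x)%E) ->
  (forall A, G A -> m A = \int[mu]_(x in A) f x)%E ->
  forall A, measurable A -> m A = (\int[mu]_(x in A) f x)%E.
Proof.
move=> mG GI GT moo mf f0 h A mA.
rewrite -[RHS]/(density_measure mu mf f0 A).
apply: (measure_unique G (fun=> setT)) => //.
by rewrite bigcup_const//; exists 0%N.
Qed.

Section eq_integral_comp.
Local Open Scope ereal_scope.
Context d1 d2 d3 (X : measurableType d1) (Y : measurableType d2)
  (Z : measurableType d3) (R : realType).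

Import HBNNSimple.

Let integral_comp_limn d0 (X0 : measurableType d0)
    (mu : {measure set X0 -> \bar R}) (phi : X0 -> Z) (w : X0 -> R)
    (h : Z -> \bar R) (mh : measurable_fun setT h) :
  measurable_fun setT phi -> measurable_fun setT w ->
  (forall x, (0 <= w x)%R) -> (forall z, 0 <= h z) ->
  \int[mu]_x (h (phi x) * (w x)%:E) =
  limn (fun n => \sum_(k \in range (nnsfun_approx measurableT mh n))
    k%:E * \int[mu]_x
      (\1_(nnsfun_approx measurableT mh n @^-1` [set k]) (phi x) * w x)%:E).
Proof.
move=> mphi mw w0 h0; set h_ := nnsfun_approx _ _.
have mhphi n : measurable_fun setT (fun x => (h_ n (phi x) * w x)%:E).
  apply/measurable_EFinP/measurable_funM => //.
  exact: (measurableT_comp (@measurable_funPT _ _ _ _ (h_ n))).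
transitivity (limn (fun n => \int[mu]_x (h_ n (phi x) * w x)%:E)).
  rewrite -monotone_convergence//.
  - apply: eq_integral => x _; apply/esym/cvg_lim => //.
    under eq_fun do rewrite EFinM.
    apply: cvgeMr => //.
    by apply: (@cvg_nnsfun_approx _ _ _ _ measurableT _ mh) => // z _.
  - by move=> n x _; rewrite lee_fin mulr_ge0.
  - move=> x _ m n mn; rewrite lee_fin ler_wpM2r//.
    exact/lefP/nd_nnsfun_approx.
apply: congr_lim; apply/funext => n.
transitivity (\int[mu]_x \sum_(k \in range (h_ n))
    (k * (\1_(h_ n @^-1` [set k]) (phi x) * w x))%:E).
  apply: eq_integral => x _; rewrite fsumEFin//; congr EFin.
  rewrite fimfunE !fsbig_finite//= mulr_suml.
  by apply: eq_bigr => k _; rewrite mulrA.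
have mI k : measurable_fun setT
    (fun x => \1_(h_ n @^-1` [set k]) (phi x) * w x)%R.
  by apply: measurable_funM => //; exact: measurableT_comp.
rewrite ge0_integral_fsum//; last 2 first.
- by move=> k; apply/measurable_EFinP/measurable_funM.
- move=> k x _; rewrite lee_fin mulrA mulr_ge0//.
  exact: nnfun_muleindic_ge0.
apply: eq_fsbigr => k; rewrite inE => -[z _ <-{k}].
under eq_integral do rewrite EFinM.
rewrite ge0_integralZl//.
- exact/measurable_EFinP.
- by move=> x _; rewrite lee_fin mulr_ge0.
- by rewrite lee_fin.
Qed.

(** The hypothesis on indicators says that two weighted image measures on [Z] coincide. By
    [integral_comp_limn] each integral is a limit of sums over the level sets of the simple
    functions approximating [h], and these sums involve only integrals of indicators. *)
Lemma eq_integral_comp (mu : {measure set X -> \bar R})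
    (nu : {measure set Y -> \bar R}) (phi : X -> Z) (psi : Y -> Z)
    (w : X -> R) (j : Y -> R) (h : Z -> \bar R) :
  measurable_fun setT phi -> measurable_fun setT psi ->
  measurable_fun setT w -> measurable_fun setT j ->
  (forall x, (0 <= w x)%R) -> (forall y, (0 <= j y)%R) ->
  (forall A, measurable A -> \int[mu]_x (\1_A (phi x) * w x)%:E =
    \int[nu]_y (\1_A (psi y) * j y)%:E) ->
  measurable_fun setT h -> (forall z, 0 <= h z) ->
  \int[mu]_x (h (phi x) * (w x)%:E) = \int[nu]_y (h (psi y) * (j y)%:E).
Proof.
move=> mphi mpsi mw mj w0 j0 H mh h0.
rewrite (integral_comp_limn mu mh mphi)// (integral_comp_limn nu mh mpsi)//.
apply: congr_lim; apply/funext => n; apply: eq_fsbigr => k _.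
by rewrite H.
Qed.

End eq_integral_comp.

Lemma integral_indicM d (T : measurableType d) (R : realType)
    (mu : {measure set T -> \bar R}) (A : set T) (f : T -> R) :
  (\int[mu]_x (\1_A x * f x)%:E = \int[mu]_(x in A) (f x)%:E)%E.
Proof.
rewrite [RHS]integral_mkcond; apply: eq_integral => x _.
rewrite /patch indicE; by case: ifPn => _; rewrite ?mul1r ?mul0r.
Qed.

(** * Translation and inversion on the real line *)

Section inversion.
Context {R : realType}.
Local Notation mu := (@lebesgue_measure R).

Lemma integral_translation (c : R) (h : R -> \bar R) :
  measurable_fun setT h -> (forall x, (0 <= h x)%E) ->
  (\int[mu]_x h x = \int[mu]_x h (x - c)%R)%E.
Proof.
move=> mh h0.
have mt : measurable_fun setT (fun x : R => x - c) by exact: measurable_funB.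
have mt' : measurable_fun setT
    ((fun x : R => x - c) : measurableTypeR R -> measurableTypeR R).
  exact: mt.
have := @ge0_integral_pushforward _ _ _ _ _ _ mt' mu setT h measurableT mh.
rewrite preimage_setT => <-; last by move=> y _; exact: h0.
apply: eq_measure_integral => A mA _.
pose m2 := [the {measure set (measurableTypeR R) -> \bar R} of
  measure_function_pushforward__canonical__measure_function_Measure mu mt'].
apply: (@lebesgue_measure_unique _ m2) => // _ [[a b]] _ <-.
rewrite /pushforward.
rewrite [X in _ = mu X](_ : _ = `]a + c, b + c]%classic); last first.
  by apply/seteqP; split => x /=; rewrite !in_itv/= ltrBrDr lerBlDr.
rewrite !lebesgue_measure_itv/= !lte_fin ltrD2r -!EFinD; case: ifP => // _.
by congr EFin; ring.
Qed.

Lemma measurable_inv : measurable_fun [set: R] (@GRing.inv R).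
Proof.
(* A real power of a nonnegative base is measurable; the factor [x] restores the sign and the
   convention 0^-1 = 0. *)
rewrite (_ : GRing.inv = fun x : R => x * (x ^+ 2) `^ (-1)); last first.
  apply/funext => x; rewrite powR_inv1 ?sqr_ge0//.
  have [->|x0] := eqVneq x 0; first by rewrite invr0 mul0r.
  by field.
apply: measurable_funM => //.
by apply: (measurableT_comp (measurable_powR _)); exact: measurable_funX.
Qed.

Lemma measurable_sqrt : measurable_fun [set: R] (@Num.sqrt R).
Proof.
rewrite (_ : Num.sqrt = fun x : R => Num.max x 0 `^ 2^-1); last first.
  apply/funext => x; have [x0|x0] := leP x 0.
    by rewrite powR12_sqrt// ler0_sqrtr// sqrtr0.
  by rewrite powR12_sqrt// ltW.
by apply: (measurableT_comp (measurable_powR _)); exact: measurable_maxr.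
Qed.

Section inversion_fixed.
Variables (b : R) (b_gt0 : 0 < b).

Let psi (y : R) : R := b ^+ 2 / (2 * y + b).
Let j (y : R) : R := 2 * b ^+ 2 / (2 * y + b) ^+ 2.

Let mpsi : measurable_fun setT psi.
Proof.
apply: measurable_funM => //; apply: (measurableT_comp measurable_inv).
by apply: measurable_funD => //; exact: measurable_funM.
Qed.

Let mj : measurable_fun setT j.
Proof.
apply: measurable_funM => //; apply: (measurableT_comp measurable_inv).
apply: measurable_funX.
by apply: measurable_funD => //; exact: measurable_funM.
Qed.

(** On [t, +oo[ the function [- psi] is a primitive of [j], and it tends to 0 at infinity. *)
Let integral_jcy (t : R) : 0 <= t ->
  (\int[mu]_(y in `[t, +oo[) (j y)%:E = (psi t)%:E)%E.
Proof.
have b0 := b_gt0; move=> t0.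
have p0 y : t <= y -> 0 < 2 * y + b by move=> ty; lra.
have dpsi y : t <= y -> is_derive y 1 (- psi) (j y).
  move=> ty; have ne0 : 2 * y + b != 0 by rewrite gt_eqF// p0.
  have lin : is_derive y 1 (fun u : R => 2 * u + b) 2.
    by apply: is_derive_eq; rewrite addr0 /GRing.scale/= mulr1.
  have dV := @is_deriveV R (fun u : R => 2 * u + b) y 2 1 ne0 lin.
  rewrite (_ : - psi = fun u => (- b ^+ 2) *: (2 * u + b)^-1); last first.
    by apply/funext => u; rewrite /psi fctE /GRing.scale/= mulNr.
  apply: is_derive_eq.
  by rewrite /j /GRing.scale/=; field.
have cj y : t <= y -> {for y, continuous j}.
  move=> ty; have ne0 : 2 * y + b != 0 by rewrite gt_eqF// p0.
  apply: cvgM; first exact: cvg_cst.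
  apply: cvgV; first by rewrite expf_neq0.
  apply: (@cvg_comp _ _ _ (fun u : R => 2 * u + b) (fun v : R => v ^+ 2));
    last exact: exprn_continuous.
  by apply: cvgD; [apply: cvgM; [exact: cvg_cst|exact: cvg_id]|exact: cvg_cst].
have psioo : (- psi) y @[y --> +oo] --> 0.
  rewrite -oppr0; apply: cvgN; rewrite -(mulr0 (b ^+ 2)).
  apply: cvgM; first exact: cvg_cst.
  apply/gtr0_cvgV0.
    near=> y; apply: p0; near: y; by apply: nbhs_pinfty_ge; rewrite num_real.
  apply/cvgryPge => A; near=> y.
  have : A - b <= y by near: y; by apply: nbhs_pinfty_ge; rewrite num_real.
  have : t <= y by near: y; by apply: nbhs_pinfty_ge; rewrite num_real.
  by lra.
rewrite (@ge0_continuous_FTC2y _ j (- psi) t 0) //.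
- by rewrite sub0e -EFinN opprK.
- by move=> y _; rewrite /j divr_ge0 ?sqr_ge0 // mulr_ge0 ?sqr_ge0.
- apply/continuous_within_itvcyP; split.
    by move=> y; rewrite in_itv/= andbT => /ltW; exact: cj.
  exact/cvg_at_right_filter/cj.
- by move=> y /ltW ty; case: (dpsi y ty).
- apply: cvg_at_right_filter; apply: differentiable_continuous.
  by apply/derivable1_diffP; case: (dpsi t (lexx t)).
- move=> y; rewrite in_itv/= andbT => /ltW ty.
  by rewrite derive1E; case: (dpsi y ty).
Unshelve. all: end_near. Qed.

Let rays : (\bigcup_k `]-oo, (k%:R : R)[%classic) = setT.
Proof.
rewrite -subTset => x _.
exists (Num.truncn x).+1 => //.
by rewrite /= in_itv/= truncnS_gt.
Qed.

(** [psi] is a decreasing bijection of ]0, +oo[ onto ]0, b[ and [j] is the absolute value of its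
    derivative. By [eq_integral_comp] it is enough to compare two measures, Lebesgue measure on ]0,
    b[ and the image under [psi] of the measure with density [j] on ]0, +oo[; on a ray ]-oo,
    x[ both equal the length of ]0, min x b[. *)
Lemma integral_inversion (h : R -> \bar R) :
  measurable_fun setT h -> (forall x, (0 <= h x)%E) ->
  (\int[mu]_x (h x * (\1_`]0%R, b[ x)%:E) =
   \int[mu]_y (h (b ^+ 2 / (2 * y + b))%R *
     (\1_`]0%R, +oo[ y * (2 * b ^+ 2 / (2 * y + b) ^+ 2))%:E))%E.
Proof.
have b0 := b_gt0; move=> mh h0.
have j0 y : 0 <= j y by rewrite /j divr_ge0 ?sqr_ge0 // mulr_ge0 ?sqr_ge0.
have mw1 : measurable_fun setT (\1_`]0%R, b[ : R -> R).
  exact: measurable_indic.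
have mw2 : measurable_fun setT (fun y : R => \1_`]0%R, +oo[ y * j y : R).
  by apply: measurable_funM => //; exact: measurable_indic.
have w20 y : 0 <= \1_`]0%R, +oo[ y * j y by rewrite mulr_ge0.
apply: (@eq_integral_comp _ _ _ _ _ _ R mu mu id psi (\1_`]0%R, b[) _ h) => //.
move=> A mA.
have me1 : measurable_fun setT (fun x : R => (\1_`]0%R, b[ x : R)%:E).
  exact/measurable_EFinP.
have me2 : measurable_fun setT (fun y : R => (\1_`]0%R, +oo[ y * j y)%:E).
  exact/measurable_EFinP.
have e10 (x : R) : (0 <= (\1_`]0%R, b[ x : R)%:E)%E by rewrite lee_fin.
have e20 (y : R) : (0 <= (\1_`]0%R, +oo[ y * j y)%:E)%E by rewrite lee_fin.
have mpsi' : measurable_fun setT (psi : measurableTypeR R -> measurableTypeR R).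
  exact: mpsi.
pose m1 := [the {measure set (measurableTypeR R) -> \bar R} of
  density_measure mu me1 e10].
pose m2 := [the {measure set (measurableTypeR R) -> \bar R} of
  measure_function_pushforward__canonical__measure_function_Measure
    (density_measure mu me2 e20) mpsi'].
have E1 B : (\int[mu]_x (\1_B x * \1_`]0%R, b[ x)%:E)%E = m1 B.
  by rewrite integral_indicM.
have E2 B : (\int[mu]_x (\1_B (psi x) * (\1_`]0%R, +oo[ x * j x))%:E)%E = m2 B.
  exact: (integral_indicM mu (psi @^-1` B)).
rewrite E1 E2.
have m1E x : m1 `]-oo, x[%classic = mu `]0, Num.min x b[%classic.
  transitivity (\int[mu]_(y in `]-oo, x[) (\1_`]0%R, b[ y)%:E)%E; first by [].
  rewrite integral_indic//; congr (mu _).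
  by apply/seteqP; split => y /=; rewrite !in_itv/= lt_min; lra.
have m2E x : m2 `]-oo, x[%classic = mu `]0, Num.min x b[%classic.
  transitivity (\int[mu]_(y in psi @^-1` `]-oo, x[)
    (\1_`]0%R, +oo[ y * j y)%:E)%E; first by [].
  rewrite -integral_indicM.
  have [x0|x0] := leP x 0.
    have -> : `]0, Num.min x b[%classic = set0 :> set R.
      by rewrite set_itv_ge// bnd_simp -leNgt ge_min x0.
    rewrite measure0 integral0_eq// => y _; congr EFin.
    rewrite !indicE; have [|] := boolP (y \in `]0%R, +oo[%classic); last first.
      by rewrite mul0r mulr0.
    rewrite inE/= in_itv/= andbT => y0.
    rewrite memNset ?mul0r//= in_itv/= => /lt_le_trans/(_ x0).
    by rewrite ltNge divr_ge0// ?sqr_ge0//; lra.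
  set x' := Num.min x b.
  have x'0 : 0 < x' by rewrite lt_min x0 b0.
  have x'b : x' <= b by rewrite ge_min lexx orbT.
  (* The solution of [psi t = x'], nonnegative because [x' <= b]. As [psi] decreases, the preimage
     of the ray within ]0, +oo[ is ]t, +oo[. *)
  pose t := (b ^+ 2 / x' - b) / 2.
  have t0 : 0 <= t.
    rewrite divr_ge0// subr_ge0 ler_pdivlMr// expr2 ler_pM2l//.
  transitivity (\int[mu]_y (\1_`]t, +oo[%classic y * j y)%:E)%E.
    apply: eq_integral => y _; rewrite mulrA; congr (EFin (_ * _)).
    rewrite !indicE -natrM mulnb -in_setI; congr ((_ \in _)%:R).
    apply/seteqP; split => u /=; rewrite !in_itv/= !andbT.
      move=> [pu u0]; have bu : 0 < 2 * u + b by lra.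
      have : psi u < x'.
        by rewrite lt_min pu /psi ltr_pdivrMr// expr2 ltr_pM2l//; lra.
      by rewrite /psi /t ltr_pdivrMr// mulrC -ltr_pdivrMr//; lra.
    move=> tu; have u0 : 0 < u by lra.
    have bu : 0 < 2 * u + b by lra.
    split => //; apply: (@lt_le_trans _ _ x'); last by rewrite ge_min lexx.
    rewrite /psi ltr_pdivrMr// mulrC -ltr_pdivrMr//.
    by move: tu; rewrite /t; lra.
  rewrite integral_indicM integral_itv_obnd_cbnd; last first.
    by apply: measurable_funTS; exact/measurable_EFinP.
  rewrite integral_jcy// lebesgue_measure_itv/= lte_fin x'0 -EFinB subr0.
  congr EFin; rewrite /psi /t; field.
  by rewrite (gt_eqF x'0)/= mulNr subrK expf_neq0// gt_eqF.
refine (@measure_unique _ R (measurableTypeR R) (@RGenInftyO.G R)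
  (fun k => `]-oo, k%:R[%classic) (RGenInftyO.measurableE R) _ _ rays m1 m2
  _ _ _ mA).
- move=> _ _ [x ->] [y ->]; exists (Num.min x y).
  by apply/seteqP; split => z /=; rewrite !in_itv/= lt_min; lra.
- by move=> k; exists k%:R.
- by move=> _ [x ->]; rewrite m1E m2E.
- move=> k; rewrite m1E lebesgue_measure_itv/=; case: ifP => _ //.
  by rewrite -EFinB ltry.
Qed.

End inversion_fixed.
End inversion.

(** * Lebesgue measure on tuples *)

Lemma measurable_mktuple d (T : measurableType d) d' (U : measurableType d') n
    (f : 'I_n -> T -> U) :
  (forall i, measurable_fun setT (f i)) ->
  measurable_fun setT (fun t => [tuple f i t | i < n]).
Proof.
move=> mf; apply/measurable_fun_tnthP => i.
rewrite (_ : _ \o _ = f i)//.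
by apply/funext => t /=; rewrite tnth_mktuple.
Qed.

Lemma measurable_fun_tnth d (T : measurableType d) d' (U : measurableType d') n
    (f : T -> n.-tuple U) i :
  measurable_fun setT f -> measurable_fun setT (fun t => tnth (f t) i).
Proof. by move/measurable_fun_tnthP; exact. Qed.

Section lebesgue_tuple_theory.
Context {R : realType}.
Local Notation mu := (@lebesgue_measure R).
Local Notation lambda := (@lebesgue_tuple R).

Lemma sigma_finite_lebesgue_tuple n : sigma_finite setT (lambda n).
Proof.
exists (fun k => [set x | forall i, `[- k%:R, k%:R]%classic (tnth x i)]).
  apply/esym; rewrite -subTset => x _.
  (* The cubes [-k, k]^n exhaust the space: any k above all the absolute values of the coordinates
     works. *)
  exists (\max_(i < n) (Num.truncn `|tnth x i|).+1)%N => // i /=.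
  rewrite in_itv/= -ler_norml (le_trans (ltW (truncnS_gt _)))// ler_nat.
  exact: (leq_bigmax i).
move=> k; split.
  rewrite (_ : [set x | _] = \bigcap_(i in [set: 'I_n])
      ((fun x : n.-tuple R => tnth x i) @^-1` `[- k%:R, k%:R])); last first.
    by apply/seteqP; split => x h; [move=> i _|move=> i]; exact: h.
  apply: fin_bigcap_measurable => // i _.
  by rewrite -[X in measurable X]setTI; exact: measurable_tnth.
rewrite (lebesgue_tuple_box (B := fun=> `[- k%:R, k%:R]%classic))//.
suff /andP[_ //] : (0 <= \prod_(i < n) mu `[(- k%:R)%R, k%:R%R] < +oo)%E.
elim/big_ind : _ => [|x y /andP[x0 xoo] /andP[y0 yoo]|i _].
- by rewrite lee01 ltry.
- by rewrite mule_ge0//= lte_mul_pinfty// ge0_fin_numE.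
- rewrite measure_ge0/= lebesgue_measure_itv/=.
  by case: ifP => _; rewrite -?EFinB ltry.
Qed.

(* [lebesgue_tuple n] is a bundled measure and cannot itself carry the          *)
(* sigma-finite instance, whence this unbundled copy.                          *)
Definition lebesgue_tuple_fun n : set (n.-tuple R) -> \bar R := lambda n.

HB.instance Definition _ n := isMeasure.Build _ _ _ (@lebesgue_tuple_fun n)
  (measure0 (lambda n)) (measure_ge0 (lambda n))
  (@measure_semi_sigma_additive _ _ _ (lambda n)).

HB.instance Definition _ n := Measure_isSigmaFinite.Build _ _ _
  (@lebesgue_tuple_fun n) (@sigma_finite_lebesgue_tuple n).

Definition lebesgue_tuple_sf n :=
  [the {sigma_finite_measure set (n.-tuple R) -> \bar R} of
    @lebesgue_tuple_fun n].

Lemma integral_lebesgue_tupleS n (h : n.+1.-tuple R -> \bar R) :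
  measurable_fun setT h -> (forall x, (0 <= h x)%E) ->
  (\int[lambda n.+1]_x h x =
   \int[lambda n]_x \int[mu]_r h (tuple_cons (x, r)))%E.
Proof.
move=> mh h0.
have -> : (\int[lambda n.+1]_x h x =
  \int[(lambda n \x lebesgue_measure)%E]_x h (tuple_cons x))%E.
  have := @ge0_integral_pushforward _ _ _ _ R _ (@measurable_tuple_cons R n)
    (lambda n \x lebesgue_measure)%E setT h measurableT mh.
  by rewrite preimage_setT => <- // y _; exact: h0.
apply: (@fubini_tonelli1 _ _ _ _ R (lebesgue_tuple_sf n) lebesgue_measure
  (h \o @tuple_cons R n)).
- by apply: measurableT_comp => //; exact: measurable_tuple_cons.
- by move=> x; exact: h0.
Qed.

Lemma lebesgue_tuple_tonelli m n (h : m.-tuple R * n.-tuple R -> \bar R) :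
  measurable_fun setT h -> (forall x, (0 <= h x)%E) ->
  (\int[lambda m]_x \int[lambda n]_y h (x, y) =
   \int[lambda n]_y \int[lambda m]_x h (x, y))%E.
Proof.
move=> mh h0.
exact: (@fubini_tonelli _ _ _ _ R (lebesgue_tuple_sf m)
  (lebesgue_tuple_sf n) h).
Qed.

Lemma measurable_lebesgue_tuple_integral d (T : measurableType d) n
    (h : T * n.-tuple R -> \bar R) :
  measurable_fun setT h -> (forall x, (0 <= h x)%E) ->
  measurable_fun setT (fun x => \int[lambda n]_y h (x, y))%E.
Proof.
move=> mh h0.
exact: (@measurable_fun_fubini_tonelli_F _ _ _ _ R (lebesgue_tuple_sf n) h).
Qed.

Lemma measurable_prod_tnth n (v : 'I_n -> R -> R) :
  (forall i, measurable_fun setT (v i)) ->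
  measurable_fun setT (fun x : n.-tuple R => \prod_i v i (tnth x i)).
Proof.
move=> mv; apply: measurable_prod => i _.
by apply: (measurableT_comp (mv i)); exact: measurable_tnth.
Qed.

(** For a coordinatewise map the Jacobian is a product, so Tonelli's theorem and induction reduce
    the formula to its one-dimensional instances. *)
Lemma lebesgue_tuple_change_variables n (phi w j : 'I_n -> R -> R)
    (h : n.-tuple R -> \bar R) :
  (forall i, measurable_fun setT (phi i)) ->
  (forall i, measurable_fun setT (w i)) ->
  (forall i, measurable_fun setT (j i)) ->
  (forall i x, 0 <= w i x) -> (forall i x, 0 <= j i x) ->
  (forall i (g : R -> \bar R),
    measurable_fun setT g -> (forall x, 0 <= g x)%E ->
    \int[mu]_x (g x * (w i x)%:E) = \int[mu]_y (g (phi i y) * (j i y)%:E))%E ->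
  measurable_fun setT h -> (forall x, (0 <= h x)%E) ->
  (\int[lambda n]_x (h x * (\prod_i w i (tnth x i))%:E) =
   \int[lambda n]_y (h [tuple phi i (tnth y i) | i < n] *
     (\prod_i j i (tnth y i))%:E))%E.
Proof.
elim: n phi w j h => [|n IH] phi w j h mphi mw mj w0 j0 H mh h0.
  apply: eq_integral => x _; rewrite !big_ord0; congr (h _ * _)%E.
  by apply/eq_from_tnth => -[].
have mP : measurable_fun setT
    (fun y : n.+1.-tuple R => [tuple phi i (tnth y i) | i < n.+1]).
  apply: measurable_mktuple => i.
  by apply: (measurableT_comp (mphi i)); exact: measurable_tnth.
have W0 (m : nat) (v : 'I_m -> R -> R) : (forall i x, 0 <= v i x) ->
    forall x : m.-tuple R, 0 <= \prod_i v i (tnth x i).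
  by move=> v0 x; apply: prodr_ge0 => i _.
rewrite integral_lebesgue_tupleS; last 2 first.
- apply: emeasurable_funM => //; apply/measurable_EFinP.
  exact: measurable_prod_tnth.
- by move=> x; rewrite mule_ge0// lee_fin W0.
rewrite integral_lebesgue_tupleS; last 2 first.
- apply: emeasurable_funM; first exact: (measurableT_comp mh mP).
  apply/measurable_EFinP; exact: measurable_prod_tnth.
- by move=> x; rewrite mule_ge0// lee_fin W0.
(* The head coordinate is already transformed and integrated out in [g]; the induction hypothesis is
   applied to [g] for the others. *)
pose g (x : n.-tuple R) :=
  (\int[mu]_y (h (tuple_cons (x, phi ord0 y)) * (j ord0 y)%:E))%E.
have mc : measurable_fun setT
    (fun p : n.-tuple R * R => tuple_cons (p.1, p.2 : measurableTypeR R)).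
  exact: (@measurable_tuple_cons R n).
have mhx x : measurable_fun setT (fun r : R => h (tuple_cons (x, r))).
  exact: (@measurable_fun_pair2 _ _ _ _ R _ _ x (measurableT_comp mh mc)).
have mhc : measurable_fun setT (fun p : n.-tuple R * R =>
    h (tuple_cons (p.1, phi ord0 p.2 : measurableTypeR R))).
  apply: (@measurableT_comp _ _ _ _ _ _ 
    (fun q : n.-tuple R * R => h (tuple_cons (q.1, q.2 : measurableTypeR R)))
    _ (fun p : n.-tuple R * R => (p.1, phi ord0 p.2))).
    exact: (measurableT_comp mh mc).
  by apply: measurable_fun_pair => //; exact: measurableT_comp.
have mg : measurable_fun setT g.
  apply: (@measurable_fun_fubini_tonelli_F _ _ _ _ R mu
    (fun p => h (tuple_cons (p.1, phi ord0 p.2)) * (j ord0 p.2)%:E)%E).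
    apply: emeasurable_funM => //; apply/measurable_EFinP.
    exact: (measurableT_comp (mj ord0) measurable_snd).
  by move=> p; rewrite mule_ge0// lee_fin.
have g0 x : (0 <= g x)%E.
  by apply: integral_ge0 => y _; rewrite mule_ge0// lee_fin.
have tS (y : n.-tuple R) (r : R) i :
    tnth (tuple_cons (y, r)) (lift ord0 i) = tnth y i.
  by rewrite /tuple_cons tnthS.
transitivity (\int[lambda n]_x
    (g x * (\prod_i w (lift ord0 i) (tnth x i))%:E))%E.
  apply: eq_integral => x _.
  rewrite /g -(H ord0 (fun r => h (tuple_cons (x, r))))//.
  rewrite -ge0_integralZr//; last 3 first.
  - apply: emeasurable_funM; first exact: mhx.
    by apply/measurable_EFinP; exact: mw.
  - by move=> r _; rewrite mule_ge0// lee_fin.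
  - by rewrite lee_fin; apply: prodr_ge0 => i _.
  apply: eq_integral => r _; rewrite big_ord_recl EFinM muleA.
  by congr (_ * _ * (_)%:E)%E; apply: eq_bigr => i _; rewrite tS.
rewrite (IH (fun i => phi (lift ord0 i)) (fun i => w (lift ord0 i))
  (fun i => j (lift ord0 i)))//; last first.
  by move=> i g' mg' g'0; exact: H.
apply: eq_integral => y _; rewrite /g.
rewrite -ge0_integralZr//; last 3 first.
- apply: emeasurable_funM; last by apply/measurable_EFinP; exact: mj.
  exact: (@measurable_fun_pair2 _ _ _ _ R _ _ _ mhc).
- by move=> r _; rewrite mule_ge0// lee_fin.
- by rewrite lee_fin; apply: prodr_ge0 => i _.
apply: eq_integral => r _; rewrite big_ord_recl EFinM muleA.
congr (h _ * _ * (_)%:E)%E; last by apply: eq_bigr => i _; rewrite tS.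
apply/eq_from_tnth => i; rewrite tnth_mktuple.
by have [k ->|->//] := unliftP ord0 i; rewrite !tS tnth_mktuple.
Qed.

End lebesgue_tuple_theory.

(** * Densities of random tuples and of pairs *)

Section joint_laws.
Context {R : realType}.
Local Notation mu := (@lebesgue_measure R).
Local Notation lambda := (@lebesgue_tuple R).

Lemma integral_lebesgue_tuple_prod n (v : 'I_n -> R -> R) :
  (forall i, measurable_fun setT (v i)) -> (forall i x, 0 <= v i x) ->
  (\int[lambda n]_x (\prod_i v i (tnth x i))%:E =
   \prod_i \int[mu]_r (v i r)%:E)%E.
Proof.
elim: n v => [|n IH] v mv v0.
  rewrite big_ord0 /=.
  under eq_integral do rewrite big_ord0.
  by rewrite integral_cst//= mul1e diracE mem_set.
rewrite integral_lebesgue_tupleS; last 2 first.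
- by apply/measurable_EFinP; exact: measurable_prod_tnth.
- by move=> x; rewrite lee_fin prodr_ge0.
rewrite big_ord_recl -(IH (fun i => v (lift ord0 i)))//.
rewrite -ge0_integralZl//; last 3 first.
- apply/measurable_EFinP.
  exact: (measurable_prod_tnth (fun i => mv (lift ord0 i))).
- by move=> x _; rewrite lee_fin prodr_ge0.
- by apply: integral_ge0 => r _; rewrite lee_fin.
apply: eq_integral => x _.
rewrite -ge0_integralZr//; last 3 first.
- by apply/measurable_EFinP; exact: mv.
- by move=> r _; rewrite lee_fin.
- by rewrite lee_fin prodr_ge0.
apply: eq_integral => r _; rewrite big_ord_recl EFinM.
by congr (_ * (_)%:E)%E; apply: eq_bigr => i _; rewrite /tuple_cons tnthS.
Qed.

Definition tuple_box n : set (set (n.-tuple R)) :=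
  [set S | exists2 B : 'I_n -> set R, (forall i, measurable (B i)) &
     S = [set x | forall i, B i (tnth x i)]].

Lemma measurable_tuple_box n : @measurable _ (n.-tuple R) = <<s @tuple_box n >>.
Proof.
apply/seteqP; split.
  apply: smallest_sub; first exact: smallest_sigma_algebra.
  rewrite -bigcup_seq/= => _ [i _ [B mB <-]]; apply: sub_sigma_algebra.
  exists (fun k => if k == i then B else setT).
    by move=> k; case: ifP.
  apply/seteqP; split => [x [_ Bx] k|x /(_ i)].
    by case: eqP => // ->.
  by rewrite eqxx => Bx; split.
apply: smallest_sub; first exact: sigma_algebra_measurable.
move=> _ [B mB ->].
rewrite (_ : [set x | _] = \bigcap_(i in [set: 'I_n])
    ((fun x : n.-tuple R => tnth x i) @^-1` (B i))); last first.
  by apply/seteqP; split => x h; [move=> i _|move=> i]; exact: h.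
apply: fin_bigcap_measurable => // i _.
by rewrite -[X in measurable X]setTI; exact: measurable_tnth.
Qed.

(** On a box, independence (taken for the full index set) factors the probability and Tonelli's
    theorem factors the integral. Boxes form a generating pi-system. *)
Lemma independent_tuple_density d (T : measurableType d) (Q : probability T R) n
    (A : 'I_n -> {RV Q >-> R}) (p : 'I_n -> R -> R) :
  (forall i, measurable_fun setT (p i)) -> (forall i x, 0 <= p i x) ->
  (forall i, has_law Q (A i) (fun B => \int[mu]_(x in B) (p i x)%:E)%E) ->
  mutually_independent Q A ->
  forall S, measurable S ->
    (Q ((fun w => [tuple A i w | i < n]) @^-1` S) =
     \int[lambda n]_(x in S) (\prod_i p i (tnth x i))%:E)%E.
Proof.
move=> mp p0 Ap indA.
have mA : measurable_fun setT (fun w => [tuple A i w | i < n]).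
  by apply: measurable_mktuple => i; exact: measurable_funPT.
apply: (@eq_density_measure _ _ R (@tuple_box n)
  [the {measure set (n.-tuple R) -> \bar R} of
    measure_function_pushforward__canonical__measure_function_Measure Q mA]
  (lambda n) (fun x => (\prod_i p i (tnth x i))%:E)).
- exact: measurable_tuple_box.
- move=> _ _ [B mB ->] [B' mB' ->]; exists (fun i => B i `&` B' i).
    by move=> i; exact: measurableI.
  apply/seteqP; split => [x [h h'] i|x h]; first by split.
  by split => i; have [] := h i.
- by exists (fun=> setT) => //; apply/seteqP.
- by rewrite /= /pushforward preimage_setT probability_setT ltry.
- by apply/measurable_EFinP; exact: measurable_prod_tnth.
- by move=> x; rewrite lee_fin prodr_ge0.
- move=> _ [B mB ->] /=; rewrite /pushforward.
  rewrite (_ : _ @^-1` _ =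
      \bigcap_(i in [set` [set: 'I_n]%SET]) (A i @^-1` B i)); last first.
    apply/seteqP; split => w /= h i.
      by move=> _; have := h i; rewrite tnth_mktuple.
    by rewrite tnth_mktuple; apply: h; rewrite /= inE.
  rewrite (indA [set: 'I_n]%SET)//.
  rewrite -integral_indicM.
  transitivity (\int[lambda n]_x
      (\prod_i (\1_(B i) (tnth x i) * p i (tnth x i)))%:E)%E.
    rewrite (@integral_lebesgue_tuple_prod n (fun i r => \1_(B i) r * p i r)).
    - apply: eq_big => [i|i _]; first by rewrite inE.
      by rewrite integral_indicM; exact: Ap.
    - by move=> i; apply: measurable_funM => //; exact: measurable_indic.
    - by move=> i x; rewrite mulr_ge0.
  apply: eq_integral => x _; congr EFin; rewrite big_split/=; congr (_ * _).
  rewrite indicE; case: (boolP (x \in _)) => [|].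
    rewrite inE/= => Bx; rewrite big1// => i _; rewrite indicE mem_set//.
  rewrite notin_setE/= => /existsNP[i nBi].
  by rewrite (bigD1 i)//= indicE memNset// mul0r.
Qed.

(** Measurable rectangles form a generating pi-system of the product, so a formula known on them
    extends to every [S]. *)
Lemma pair_density d (T : measurableType d) (P : probability T R) m n
    (X : T -> m.-tuple R) (Y : T -> n.-tuple R)
    (rho : m.-tuple R * n.-tuple R -> R) :
  measurable_fun setT X -> measurable_fun setT Y ->
  measurable_fun setT rho -> (forall p, 0 <= rho p) ->
  (forall A B, measurable A -> measurable B ->
    P (X @^-1` A `&` Y @^-1` B) =
    \int[lambda m]_(x in A) \int[lambda n]_(y in B) (rho (x, y))%:E)%E ->
  forall S, measurable S ->
   (P ((fun w => (X w, Y w)) @^-1` S) =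
   \int[lambda m]_x \int[lambda n]_y (\1_S (x, y) * rho (x, y))%:E)%E.
Proof.
move=> mX mY mrho rho0 H S mS.
have mXY := measurable_fun_pair mX mY.
have mrho' : measurable_fun setT (EFin \o rho) by exact/measurable_EFinP.
pose prodl := (@lebesgue_tuple_sf R m \x @lebesgue_tuple_sf R n)%E.
have E S' : measurable S' ->
  (\int[prodl]_(z in S') (rho z)%:E =
   \int[lambda m]_x \int[lambda n]_y (\1_S' (x, y) * rho (x, y))%:E)%E.
  move=> mS'; rewrite -integral_indicM.
  apply: (@fubini_tonelli1 _ _ _ _ R (lebesgue_tuple_sf m) (lebesgue_tuple_sf n)
    (fun z => (\1_S' z * rho z)%:E)).
    by apply/measurable_EFinP/measurable_funM => //; exact: measurable_indic.
  by move=> z; rewrite lee_fin mulr_ge0.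
rewrite -E//.
apply: (@eq_density_measure _ _ R
  [set C | exists2 A, measurable A & exists2 B, measurable B & A `*` B = C]
  [the {measure set (m.-tuple R * n.-tuple R) -> \bar R} of
    measure_function_pushforward__canonical__measure_function_Measure P mXY]
  prodl (EFin \o rho)) => //.
- exact: measurable_prod_measurableType.
- move=> _ _ [A mA [B mB <-]] [A' mA' [B' mB' <-]].
  exists (A `&` A'); first exact: measurableI.
  by exists (B `&` B'); [exact: measurableI|rewrite setXI].
- by exists setT => //; exists setT => //; rewrite setXTT.
- by rewrite /= /pushforward preimage_setT probability_setT ltry.
- move=> _ [A mA [B mB <-]].
  rewrite /= /pushforward (_ : _ @^-1` _ = X @^-1` A `&` Y @^-1` B)// H//.
  rewrite E; last exact: measurableX.
  rewrite [LHS]integral_mkcond; apply: eq_integral => x _; rewrite patchE.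
  case: ifPn => [xA|xA].
    rewrite -integral_indicM; apply: eq_integral => y _; congr (EFin (_ * _)).
    by rewrite !indicE in_setX xA.
  by rewrite integral0_eq// => y _; rewrite indicE in_setX (negbTE xA) mul0r.
Qed.
End joint_laws.

(** * Positive definite matrices *)

Section dot.
Context {R : realType}.
Implicit Types m n : nat.

Lemma dotC n (u v : 'cV[R]_n) : dot u v = dot v u.
Proof. by rewrite /dot -[u^T *m v]trmxK trmx_mul trmxK mxE. Qed.

Lemma dotDl n (u v w : 'cV[R]_n) : dot (u + v) w = dot u w + dot v w.
Proof. by rewrite /dot linearD mulmxDl mxE. Qed.

Lemma dotDr n (u v w : 'cV[R]_n) : dot u (v + w) = dot u v + dot u w.
Proof. by rewrite /dot mulmxDr mxE. Qed.

Lemma dotNr n (u v : 'cV[R]_n) : dot u (- v) = - dot u v.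
Proof. by rewrite /dot mulmxN mxE. Qed.

Lemma dotE n (u v : 'cV[R]_n) : dot u v = \sum_i u i 0 * v i 0.
Proof. by rewrite /dot mxE; apply: eq_bigr => i _; rewrite mxE. Qed.

Lemma dot0l n (v : 'cV[R]_n) : dot 0 v = 0.
Proof. by rewrite /dot trmx0 mul0mx mxE. Qed.

Lemma dot0r n (v : 'cV[R]_n) : dot v 0 = 0.
Proof. by rewrite dotC dot0l. Qed.

Lemma dot_trmx m n (M : 'M[R]_(m, n)) u v : dot u (M *m v) = dot (M^T *m u) v.
Proof. by rewrite /dot trmx_mul trmxK mulmxA. Qed.

Lemma dot_col_mx m n (u u' : 'cV[R]_m) (v v' : 'cV[R]_n) :
  dot (col_mx u v) (col_mx u' v') = dot u u' + dot v v'.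
Proof. by rewrite /dot tr_col_mx mul_row_col mxE. Qed.

Lemma dot_diag_mx n (d : 'rV[R]_n) (u v : 'cV[R]_n) :
  dot u (diag_mx d *m v) = \sum_i d 0 i * u i 0 * v i 0.
Proof.
by rewrite dotE; apply: eq_bigr => i _; rewrite mul_diag_mx mxE mulrCA mulrA.
Qed.

Lemma dot_delta_mx n (M : 'M[R]_n) i :
  dot (delta_mx i 0) (M *m delta_mx i 0) = M i i.
Proof. by rewrite /dot trmx_delta -rowE -colE !mxE. Qed.

End dot.

Section posdefmx.
Context {R : realType}.
Implicit Types m n : nat.

Lemma posdefmx_unitmx n (H : 'M[R]_n) : posdefmx H -> H \in unitmx.
Proof.
move=> [HT H0]; rewrite -row_free_unit -kermx_eq0; apply/eqP/row_matrixP => i.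
rewrite row0; apply/eqP/negP => /negP k0.
have := H0 (row i (kermx H))^T; rewrite trmx_eq0 => /(_ k0).
(* A nonzero vector of the kernel would make the quadratic form vanish. *)
by rewrite -{2}HT -trmx_mul -row_mul mulmx_ker row0 trmx0 dot0r ltxx.
Qed.

Lemma trmx_inv_sym n (H : 'M[R]_n) : H^T = H -> (invmx H)^T = invmx H.
Proof. by move=> HT; rewrite trmx_inv HT. Qed.

Lemma posdefmx_diag_gt0 n (H : 'M[R]_n) i : posdefmx H -> 0 < H i i.
Proof.
move=> [_ H0]; rewrite -(dot_delta_mx H i); apply: H0.
apply/eqP => /matrixP/(_ i 0); rewrite !mxE !eqxx => /eqP.
by rewrite oner_eq0.
Qed.

Lemma posdefmx_inv_ge0 n (H : 'M[R]_n) u :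
  posdefmx H -> 0 <= dot u (invmx H *m u).
Proof.
move=> pH; have [HT H0] := pH; have uH := posdefmx_unitmx pH.
set v := invmx H *m u.
have -> : u = H *m v by rewrite mulKVmx.
rewrite dotC; have [->|v0] := eqVneq v 0; first by rewrite dot0l.
exact/ltW/H0.
Qed.

Lemma posdefmx_block m n (A : 'M[R]_m) (B : 'M[R]_(m, n)) (D : 'M[R]_n) :
  A^T = A -> D^T = D ->
  posdefmx (block_mx A B B^T D) <->
  forall u v, (u != 0) || (v != 0) ->
    0 < dot u (A *m u) + 2 * dot u (B *m v) + dot v (D *m v).
Proof.
move=> AT DT.
have E u v : dot (col_mx u v) (block_mx A B B^T D *m col_mx u v) =
    dot u (A *m u) + 2 * dot u (B *m v) + dot v (D *m v).
  rewrite mul_block_col dot_col_mx !dotDr [dot v (B^T *m u)]dot_trmx trmxK.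
  rewrite [dot (B *m v) u]dotC; ring.
have C0 (u : 'cV[R]_m) (v : 'cV[R]_n) :
    (col_mx u v != 0) = (u != 0) || (v != 0).
  by rewrite col_mx_eq0 negb_and.
split => [[_ h] u v uv0|h].
  by rewrite -E; apply: h; rewrite C0.
split; first by rewrite tr_block_mx AT DT trmxK.
by move=> u; rewrite -[u]vsubmxK C0 E; exact: h.
Qed.

(** Completing the square: the block form at (u, v) is the form of [A] at u + A^-1 B v plus the form
    of the Schur complement at v. *)
Lemma posdefmx_schur m n (A : 'M[R]_m) (B : 'M[R]_(m, n)) (D : 'M[R]_n) :
  A^T = A -> D^T = D ->
  posdefmx (block_mx A B B^T D) <->
  posdefmx A /\ posdefmx (D - B^T *m invmx A *m B).
Proof.
move=> AT DT; rewrite posdefmx_block//.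
have ST : (invmx A)^T = invmx A by exact: trmx_inv_sym.
have E u v : A \in unitmx ->
    dot u (A *m u) + 2 * dot u (B *m v) + dot v (D *m v) =
    dot (u + invmx A *m B *m v) (A *m (u + invmx A *m B *m v)) +
    dot v ((D - B^T *m invmx A *m B) *m v).
  move=> uA; rewrite mulmxDr !mulmxA mulmxV// mul1mx.
  rewrite !(dotDl, dotDr) mulmxBl dotDr dotNr.
  have -> : dot (invmx A *m B *m v) (A *m u) = dot u (B *m v).
    by rewrite dot_trmx AT !mulmxA mulmxV// mul1mx dotC.
  have -> : dot v (B^T *m invmx A *m B *m v) = dot (invmx A *m B *m v) (B *m v).
    by rewrite -!mulmxA dot_trmx trmxK dotC.
  by ring.
split => [h|[pA [_ pS]] u v uv0].
  have pA : posdefmx A.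
    split=> // u u0; have := h u 0; rewrite u0 => /(_ isT).
    by rewrite !mulmx0 !dot0r mulr0 !addr0.
  have uA := posdefmx_unitmx pA.
  split=> //; split.
    by rewrite linearB/= DT !trmx_mul trmxK ST mulmxA.
  (* This choice of u kills the completed square and leaves the Schur complement alone. *)
  move=> v v0; have := h (- (invmx A *m B *m v)) v; rewrite v0 orbT => /(_ isT).
  by rewrite E// addNr dot0l add0r.
have uA := posdefmx_unitmx pA.
rewrite E//; set w := u + _.
have [v0|v0] := eqVneq v 0.
  move: uv0; rewrite v0 eqxx orbF => u0.
  by rewrite dot0l addr0 /w v0 mulmx0 addr0; case: pA => _; exact.
rewrite ltr_wpDl ?pS//.
have [->|w0] := eqVneq w 0; first by rewrite dot0l.
by case: pA => _ /(_ w w0)/ltW.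
Qed.

(** Block Gaussian elimination from the upper left corner; [det_schurr] eliminates from the lower
    right one. Equating the two gives [det_delta]. *)
Lemma det_schur m n (A : 'M[R]_m) (B : 'M[R]_(m, n)) C (D : 'M[R]_n) :
  A \in unitmx ->
  \det (block_mx A B C D) = \det A * \det (D - C *m invmx A *m B).
Proof.
move=> uA.
have -> : block_mx A B C D =
    block_mx 1%:M 0 (C *m invmx A) 1%:M *m
    block_mx A B 0 (D - C *m invmx A *m B).
  rewrite mulmx_block !mul1mx !mul0mx !addr0 -mulmxA mulVmx// mulmx1.
  by rewrite addrC subrK.
by rewrite det_mulmx det_lblock det_ublock !det1 !mul1r.
Qed.

Lemma det_schurr m n (A : 'M[R]_m) (B : 'M[R]_(m, n)) C (D : 'M[R]_n) :
  D \in unitmx ->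
  \det (block_mx A B C D) = \det (A - B *m invmx D *m C) * \det D.
Proof.
move=> uD.
have -> : block_mx A B C D =
    block_mx 1%:M (B *m invmx D) 0 1%:M *m
    block_mx (A - B *m invmx D *m C) 0 C D.
  rewrite mulmx_block !mul1mx !mul0mx !add0r subrK.
  by rewrite -mulmxA mulVmx// mulmx1.
by rewrite det_mulmx det_ublock det_lblock !det1 !mul1r.
Qed.

(** Induction on the size: splitting off the first coordinate writes the determinant as a positive
    diagonal entry times the determinant of a positive definite Schur complement. *)
Lemma posdefmx_det_gt0 n (H : 'M[R]_n) : posdefmx H -> 0 < \det H.
Proof.
elim: n H => [|n IH] H pH; first by rewrite det_mx00.
have HT := pH.1.
pose H' : 'M[R]_(1 + n) := H.
have E : H = block_mx (ulsubmx H') (ursubmx H') (ursubmx H')^T (drsubmx H').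
  by rewrite trmx_ursub (_ : H'^T = H')// submxK.
have AT : (ulsubmx H')^T = ulsubmx H' by rewrite trmx_ulsub (_ : H'^T = H').
have DT : (drsubmx H')^T = drsubmx H' by rewrite trmx_drsub (_ : H'^T = H').
move: pH; rewrite {}E => /(posdefmx_schur _ AT DT)[pA pS].
rewrite (det_schur _ _ _ (posdefmx_unitmx pA)) mulr_gt0 ?IH//.
by rewrite det_mx11 (posdefmx_diag_gt0 0 pA).
Qed.

End posdefmx.

(** * The density identity *)

Section diag.
Context {R : realType}.

Lemma mul_diag_mxv (F : fieldType) n (d : 'rV[F]_n) :
  (forall i, d 0 i != 0) -> diag_mx d *m diag_mx (map_mx GRing.inv d) = 1%:M.
Proof.
move=> d0; rewrite mulmx_diag -diag_const_mx; congr diag_mx.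
by apply/rowP => i; rewrite !mxE mulfV.
Qed.

Lemma diag_mx_unit (F : fieldType) n (d : 'rV[F]_n) :
  (forall i, d 0 i != 0) -> diag_mx d \in unitmx.
Proof. by move=> d0; have /mulmx1_unit[] := mul_diag_mxv d0. Qed.

Lemma invmx_diag (F : fieldType) n (d : 'rV[F]_n) :
  (forall i, d 0 i != 0) -> invmx (diag_mx d) = diag_mx (map_mx GRing.inv d).
Proof.
move=> d0; rewrite -[RHS]mul1mx -(mulVmx (diag_mx_unit d0)) -mulmxA.
by rewrite mul_diag_mxv// mulmx1.
Qed.

Lemma posdefmx_diag n (d : 'rV[R]_n) :
  (forall i, 0 < d 0 i) -> posdefmx (diag_mx d).
Proof.
move=> d0; split; first exact: tr_diag_mx.
move=> u /matrix0Pn[i [j]]; rewrite ord1 => ui0.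
rewrite dot_diag_mx (bigD1 i)//= ltr_pwDl//.
  by rewrite -mulrA mulr_gt0// -expr2 exprn_even_gt0.
by apply: sumr_ge0 => k _; rewrite -mulrA -expr2 mulr_ge0 ?sqr_ge0 ?ltW.
Qed.

Lemma trmx_Hmx n (W : 'M[R]_n) b : W^T = W -> (Hmx W b)^T = Hmx W b.
Proof. by move=> WT; rewrite /Hmx linearB/= tr_diag_mx WT. Qed.

Lemma posdef_Hmx_gt0 n (W : 'M[R]_n) b i : 0 <= W i i ->
  posdefmx (Hmx W b) -> 0 < tnth b i.
Proof.
move=> Wi pH; have := posdefmx_diag_gt0 i pH.
by rewrite !mxE eqxx mulr1n; lra.
Qed.

Lemma prodr_sqrt n (f : 'I_n -> R) : (forall i, 0 <= f i) ->
  \prod_i Num.sqrt (f i) = Num.sqrt (\prod_i f i).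
Proof.
move=> f0; suff [] : \prod_i Num.sqrt (f i) = Num.sqrt (\prod_i f i) /\
   0 <= \prod_i f i by [].
elim/big_ind2 : _ => [|u v u' v' [-> v0] [-> v'0]|i _].
- by rewrite sqrtr1 ler01.
- by rewrite sqrtrM// mulr_ge0.
- by [].
Qed.

End diag.

Section identity.
Context {R : realType} {n : nat}.
Variables (W : 'M[R]_n) (WT : W^T = W).
Variables (x y : n.-tuple R).
Let b (i : 'I_n) : R := 2 * tnth x i.
Let B : 'M[R]_n := diag_mx (\row_i b i).
Let H := Hmx W x.
Let G := invmx H.

(** K = B^-1 H, hence W K^-1 = W G B, and W = B - H. *)
Lemma Wtilde_Hmx : (forall i, 0 < tnth x i) -> H \in unitmx ->
  Wtilde W x = B *m G *m B - B.
Proof.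
move=> x0 uH.
have b0 i : (\row_i b i) 0 i != 0 by rewrite mxE mulf_neq0 ?gt_eqF.
have -> : Wtilde W x = W *m (G *m B).
  congr (_ *m _); rewrite /Kmx.
  have uB : B \in unitmx by exact: diag_mx_unit.
  rewrite (_ : 1%:M - _ = invmx B *m H); last first.
    rewrite /H /Hmx mulmxBr mulVmx// invmx_diag//; congr (_ - diag_mx _ *m _).
    by apply/rowP => i; rewrite !mxE.
  have -> : invmx B *m H = invmx (G *m B); last by rewrite invmxK.
  have uG : G \in unitmx by rewrite unitmx_inv.
  have uGB : G *m B \in unitmx by rewrite unitmx_mul uG.
  rewrite -{1}[H]invmxK -[LHS]mulmx1 -(mulmxV uGB) !mulmxA.
  by rewrite mulmxKV// mulVmx// mul1mx.
rewrite (_ : W = B - H); last by rewrite /H /Hmx opprB addrC subrK.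
by rewrite mulmxBl !mulmxA mulmxV// mul1mx.
Qed.

Hypothesis x0 : forall i, 0 < tnth x i.
Let a (i : 'I_n) : R := 2 * tnth y i.
Let S := Hmx (Wtilde W x) y.
Let E : 'M[R]_n := diag_mx (\row_i (a i + b i)).
Let A (i : 'I_n) : R := b i ^+ 2 / (2 * tnth y i + b i).
Let delta : n.-tuple R := [tuple tnth x i - A i / 2 | i < n].
Let H' := Hmx W delta.

Lemma Hmx_Wtilde : H \in unitmx -> S = E - B *m G *m B.
Proof.
move=> uH; rewrite /S /Hmx Wtilde_Hmx// opprB addrA /E /B -linearD/=.
by congr (diag_mx _ - _); apply/rowP => i; rewrite !mxE.
Qed.

Hypothesis y0 : forall i, 0 < tnth y i.

Let ab0 i : 0 < a i + b i.
Proof. by rewrite /a /b addr_gt0// mulr_gt0. Qed.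

Lemma Hmx_delta : H' = H - B *m invmx E *m B.
Proof.
rewrite /H' /H /Hmx addrAC; congr (_ - _).
rewrite invmx_diag ?mulmx_diag -?linearB/=; last first.
  by move=> i; rewrite mxE gt_eqF.
congr diag_mx; apply/rowP => i; rewrite !mxE tnth_mktuple /A /a /b.
by have := ab0 i; rewrite /a /b => ne; field; rewrite gt_eqF.
Qed.

Let posE : posdefmx E.
Proof. by apply: posdefmx_diag => i; rewrite mxE. Qed.

Let ET : E^T = E. Proof. exact: tr_diag_mx. Qed.
Let BT : B^T = B. Proof. exact: tr_diag_mx. Qed.
Let HT : H^T = H. Proof. exact: trmx_Hmx. Qed.

(** [[E, B], [B, H]] and [[H, B], [B, E]] carry the same quadratic form with the two vectors
    exchanged. The Schur complement of [E] in the first is [H'], that of [H] in the second is [S],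
    and [E] is a positive diagonal matrix. *)
Lemma posdefmx_delta : posdefmx H' <-> posdefmx H /\ posdefmx S.
Proof.
have e1 : posdefmx (block_mx E B B^T H) <-> posdefmx H'.
  by rewrite (posdefmx_schur _ ET HT) BT -Hmx_delta; split => [[]|].
have e2 : posdefmx (block_mx H B B^T E) <->
    posdefmx H /\ posdefmx (E - B *m G *m B).
  by rewrite (posdefmx_schur _ HT ET) BT.
have dotB u v : dot v (B *m u) = dot u (B *m v) by rewrite dot_trmx BT dotC.
have e3 : posdefmx (block_mx E B B^T H) <-> posdefmx (block_mx H B B^T E).
  rewrite !posdefmx_block//; split => h u v; rewrite orbC => /h.
    by rewrite dotB; lra.
  by rewrite dotB; lra.
rewrite -e1 e3 e2; split => -[pH pS]; split => //.
  by rewrite Hmx_Wtilde//; exact: posdefmx_unitmx.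
by rewrite -Hmx_Wtilde//; exact: posdefmx_unitmx.
Qed.

Lemma det_delta : posdefmx H ->
  \det H * \det S = \prod_i (a i + b i) * \det H'.
Proof.
move=> /posdefmx_unitmx uH; have uE := posdefmx_unitmx posE.
rewrite Hmx_Wtilde// -det_schur// det_schurr// -Hmx_delta mulrC; congr (_ * _).
by rewrite det_diag; apply: eq_bigr => i _; rewrite mxE.
Qed.

Lemma invmx_delta : posdefmx H -> posdefmx S ->
  invmx H' = G + G *m B *m invmx S *m B *m G.
Proof.
move=> pH pS; have uH := posdefmx_unitmx pH; have uS := posdefmx_unitmx pS.
have uE := posdefmx_unitmx posE.
have pH' : posdefmx H' by exact/posdefmx_delta.
have uH' := posdefmx_unitmx pH'.
have key : H' *m (G + G *m B *m invmx S *m B *m G) = 1%:M.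
  have BGB : B *m G *m B = E - S by rewrite Hmx_Wtilde// opprB addrC subrK.
  have HG : H' *m G = 1%:M - B *m invmx E *m B *m G.
    by rewrite Hmx_delta mulmxBl mulmxV.
  (* The resolvent-type identity behind Woodbury's formula, from B G B = E - S; it makes the product
     with [H'] telescope to the identity. *)
  have ES : invmx E *m (B *m G *m B) *m invmx S = invmx S - invmx E.
    by rewrite BGB mulmxBr mulVmx// mulmxBl mul1mx -mulmxA mulmxV// mulmx1.
  have BE : (1%:M - B *m invmx E *m B *m G) *m B *m invmx S = B *m invmx E.
    rewrite !mulmxBl mul1mx (_ : B *m invmx E *m B *m G *m B *m invmx S =
      B *m (invmx E *m (B *m G *m B) *m invmx S)); last by rewrite !mulmxA.
    by rewrite ES mulmxBr opprB addrC subrK.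
  by rewrite mulmxDr !mulmxA HG BE subrK.
by rewrite -[RHS]mul1mx -(mulVmx uH') -mulmxA key mulmx1.
Qed.

Variables (theta eta z : 'cV[R]_n).
Hypotheses (theta0 : forall i, 0 < theta i 0) (z0 : forall i, 0 < z i 0).
Let zeta : 'cV[R]_n := \col_i (z i 0)^-1.
Let tt := theta_tilde z x.
Let et := eta_tilde W eta x.

(** With B theta~ = 1/z ([f2]) and eta~ = B G eta ([f3]), all the tilde terms become forms in [G].
    The terms <zeta, G zeta> cancel between [f8] and [f4], the terms <eta, G zeta> between [f8] and
    [f6], and [f7] is Woodbury's formula. What remains splits over the coordinates. *)
Lemma exponent_delta : posdefmx H -> posdefmx S ->
  - (2^-1 * dot theta (H *m theta))
    - 2^-1 * dot (eta + zeta) (G *m (eta + zeta)) + dot (eta + zeta) theta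
  + (- (2^-1 * dot tt (S *m tt)) - 2^-1 * dot et (invmx S *m et) + dot et tt)
  = - (2^-1 * dot theta (H' *m theta)) - 2^-1 * dot eta (invmx H' *m eta)
    + dot eta theta
  + \sum_i - ((z i 0 ^+ 2)^-1 * (A i - (theta i 0 * z i 0)^-1) ^+ 2 /
      (2 * (theta i 0 * z i 0)^-1 ^+ 2 * A i)).
Proof.
move=> pH pS; have uH := posdefmx_unitmx pH; have uS := posdefmx_unitmx pS.
have GT : G^T = G by exact: trmx_inv_sym.
have b0 i : 0 < b i by rewrite mulr_gt0.
have f1 : dot theta (H *m theta) =
    dot theta (H' *m theta) + \sum_i A i * theta i 0 ^+ 2.
  have -> : H = H' + diag_mx (\row_i A i).
    rewrite /H /H' /Hmx addrAC -linearD/=; congr (diag_mx _ - _).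
    by apply/rowP => i; rewrite !mxE tnth_mktuple; lra.
  rewrite mulmxDl dotDr dot_diag_mx; congr (_ + _); apply: eq_bigr => i _.
  by rewrite mxE expr2 mulrA.
have f2 : B *m tt = zeta.
  apply/colP => i; rewrite mul_diag_mx !mxE /b; field.
  by rewrite !gt_eqF.
have f3 : et = B *m (G *m eta).
  rewrite /et /eta_tilde -/H -/G (_ : W = B - H); last first.
    by rewrite /H /Hmx opprB addrC subrK.
  by rewrite mulmxBl mulKVmx// addrC subrK.
have f4 : dot tt (S *m tt) =
    \sum_i (a i + b i) * (b i * z i 0)^-1 ^+ 2 - dot zeta (G *m zeta).
  rewrite Hmx_Wtilde// mulmxBl dotDr dotNr; congr (_ - _).
    rewrite dot_diag_mx; apply: eq_bigr => i _.
    by rewrite !mxE -mulrA -expr2.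
  by rewrite -!mulmxA f2 dot_trmx BT f2.
have f6 : dot et tt = dot eta (G *m zeta).
  by rewrite f3 dotC dot_trmx BT f2 dotC [RHS]dot_trmx GT.
have f7 : dot eta (invmx H' *m eta) =
    dot eta (G *m eta) + dot et (invmx S *m et).
  rewrite invmx_delta// mulmxDl dotDr; congr (_ + _).
  by rewrite -!mulmxA dot_trmx GT dot_trmx BT -f3.
have f8 : dot (eta + zeta) (G *m (eta + zeta)) =
    dot eta (G *m eta) + 2 * dot eta (G *m zeta) + dot zeta (G *m zeta).
  rewrite mulmxDr !dotDl !dotDr.
  have -> : dot zeta (G *m eta) = dot eta (G *m zeta).
    by rewrite dot_trmx GT dotC.
  by ring.
rewrite f1 f4 f6 f7 f8 dotDl.
have -> : \sum_i - ((z i 0 ^+ 2)^-1 * (A i - (theta i 0 * z i 0)^-1) ^+ 2 /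
      (2 * (theta i 0 * z i 0)^-1 ^+ 2 * A i)) =
   - 2^-1 * (\sum_i A i * theta i 0 ^+ 2) + dot zeta theta
   - 2^-1 * \sum_i (a i + b i) * (b i * z i 0)^-1 ^+ 2.
  rewrite dotE !mulr_sumr -big_split/= -sumrB; apply: eq_bigr => i _.
  rewrite mxE /A -[2 * tnth y i]/(a i); field.
  by rewrite !gt_eqF.
by field.
Qed.

Lemma ig_pdf_delta i :
  ig_pdf (theta i 0 * z i 0)^-1 (z i 0 ^+ 2)^-1 (A i) *
    (2 * b i ^+ 2 / (2 * tnth y i + b i) ^+ 2) =
  Num.sqrt (2 / pi) * tt i 0 / Num.sqrt (a i + b i) *
  expR (- ((z i 0 ^+ 2)^-1 * (A i - (theta i 0 * z i 0)^-1) ^+ 2 /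
      (2 * (theta i 0 * z i 0)^-1 ^+ 2 * A i))).
Proof.
have b0 : 0 < b i by rewrite mulr_gt0.
have ab := ab0 i; have zi := z0 i; have pi0 : 0 < (pi : R) by exact: pi_gt0.
have A0 : 0 < A i by rewrite divr_gt0// exprn_gt0.
rewrite /ig_pdf A0 mulrAC; congr (_ * _).
rewrite !mxE -/(b i) -[2 * tnth y i]/(a i).
move: (pi : R) pi0 => p p0.
(* A perfect square is isolated, so that only sqrt(2/pi) and sqrt(a_i + b_i) survive the root. *)
have -> : (z i 0 ^+ 2)^-1 / (2 * p * A i ^+ 3) =
    2 / p * ((a i + b i) * ((a i + b i) / (2 * z i 0 * b i ^+ 3)) ^+ 2 ).
  rewrite /A -[2 * tnth y i]/(a i); field.
  by rewrite !gt_eqF.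
have s0 : 0 < Num.sqrt (a i + b i) by rewrite sqrtr_gt0.
rewrite sqrtrM ?divr_ge0 ?ltW// [Num.sqrt ((a i + b i) * _)]sqrtrM ?ltW//.
rewrite sqrtr_sqr ger0_norm; last first.
  by rewrite divr_ge0 ?ltW// !mulr_gt0// exprn_gt0.
have -> : a i + b i = Num.sqrt (a i + b i) ^+ 2 by rewrite sqr_sqrtr// ltW.
rewrite sqrtr_sqr gtr0_norm//; field.
by rewrite !gt_eqF.
Qed.

(** By [posdefmx_delta] both sides vanish together; on the common support the roots of the
    determinants match by [det_delta] and the exponentials by [exponent_delta]. *)
Lemma nu_pdf_delta :
  nu_pdf W theta eta delta *
    ((\prod_i ig_pdf (theta i 0 * z i 0)^-1 (z i 0 ^+ 2)^-1 (A i)) *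
     \prod_i (2 * b i ^+ 2 / (2 * tnth y i + b i) ^+ 2)) =
  nu_pdf W theta (eta + zeta) x * nu_pdf (Wtilde W x) tt et y.
Proof.
rewrite -big_split/=; under eq_bigr do rewrite ig_pdf_delta.
rewrite /nu_pdf -/H -/S -/H' -/G.
case: asboolP => [pH'|npH']; last first.
  rewrite mul0r; apply/esym.
  case: asboolP => [pH|]; last by rewrite mul0r.
  case: asboolP => [pS|]; last by rewrite mulr0.
  by exfalso; apply: npH'; exact/posdefmx_delta.
have [pH pS] := posdefmx_delta.1 pH'.
rewrite (asboolT pH) (asboolT pS).
have dH := posdefmx_det_gt0 pH; have dS := posdefmx_det_gt0 pS.
have dH' := posdefmx_det_gt0 pH'.
(* The factors sqrt(2/pi) of the n Inverse Gaussian densities make up the constant of the second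
   nu. *)
have cE : (2 / pi) `^ (n%:R / 2) = \prod_(i < n) Num.sqrt (2 / pi) :> R.
  have p0 : 0 <= 2 / pi :> R by rewrite divr_ge0// pi_ge0.
  rewrite [n%:R / 2]mulrC powRrM powR12_sqrt// powR_mulrn ?sqrtr_ge0//.
  by rewrite prodr_const card_ord.
have := exponent_delta pH pS; set e1 := _ + dot (eta + zeta) theta.
set e2 := _ + dot et tt; set e3 := _ + dot eta theta => eE.
rewrite !big_split/= -cE prodfV prodr_sqrt; last by move=> i; exact: ltW.
rewrite -expR_sum.
set Z := \sum_i _ in eE *.
set c := _ `^ _.
have eE' : expR e3 * expR Z = expR e1 * expR e2 by rewrite -!expRD eE.
have dE : Num.sqrt (\det H) * Num.sqrt (\det S) =
    Num.sqrt (\prod_i (a i + b i)) * Num.sqrt (\det H').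
  by rewrite -!sqrtrM ?(ltW dH)// ?det_delta// prodr_ge0// => i _; exact: ltW.
have sH : Num.sqrt (\det H) != 0 by rewrite gt_eqF// sqrtr_gt0.
have sS : Num.sqrt (\det S) != 0 by rewrite gt_eqF// sqrtr_gt0.
have sH' : Num.sqrt (\det H') != 0 by rewrite gt_eqF// sqrtr_gt0.
have sP : Num.sqrt (\prod_i (a i + b i)) != 0.
  by rewrite gt_eqF// sqrtr_gt0 prodr_gt0.
set T := \prod_i theta i 0; set U := \prod_i tt i 0.
transitivity (c * c * T * U * (expR e3 * expR Z) /
  (Num.sqrt (\prod_i (a i + b i)) * Num.sqrt (\det H'))).
  by field; rewrite sH' sP.
by rewrite eE' -dE; field; rewrite sH sS.
Qed.

End identity.

(** * Measurability of the densities *)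

Section measurable_mx.
Context {R : realType} {d : measure_display} {T : measurableType d}.
Implicit Types m n p : nat.

(** Measurability is stated entry by entry, which avoids a sigma-algebra on matrices. *)
Definition measurable_mx m n (F : T -> 'M[R]_(m, n)) :=
  forall i j, measurable_fun setT (fun t => F t i j).

Lemma measurable_mxM m n p (F : T -> 'M[R]_(m, n)) (G : T -> 'M[R]_(n, p)) :
  measurable_mx F -> measurable_mx G -> measurable_mx (fun t => F t *m G t).
Proof.
move=> mF mG i j; under eq_fun do rewrite mxE.
by apply: measurable_sum => k; exact: measurable_funM.
Qed.

Lemma measurable_mxD m n (F G : T -> 'M[R]_(m, n)) :
  measurable_mx F -> measurable_mx G -> measurable_mx (fun t => F t + G t).
Proof.
by move=> mF mG i j; under eq_fun do rewrite mxE; exact: measurable_funD.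
Qed.

Lemma measurable_mxN m n (F : T -> 'M[R]_(m, n)) :
  measurable_mx F -> measurable_mx (fun t => - F t).
Proof.
by move=> mF i j; under eq_fun do rewrite mxE; exact: measurableT_comp.
Qed.

Lemma measurable_mx_tr m n (F : T -> 'M[R]_(m, n)) :
  measurable_mx F -> measurable_mx (fun t => (F t)^T).
Proof. by move=> mF i j; under eq_fun do rewrite mxE; exact: mF. Qed.

Lemma measurable_mx_cst m n (M : 'M[R]_(m, n)) : measurable_mx (fun=> M).
Proof. by move=> i j; exact: measurable_cst. Qed.

Lemma measurable_mx_diag n (F : T -> 'rV[R]_n) :
  measurable_mx F -> measurable_mx (fun t => diag_mx (F t)).
Proof.
move=> mF i j; under eq_fun do rewrite mxE.
case: (i == j); under eq_fun do rewrite ?mulr1n ?mulr0n;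
  last exact: measurable_cst.
exact: mF.
Qed.

Lemma measurable_dot n (F G : T -> 'cV[R]_n) :
  measurable_mx F -> measurable_mx G ->
  measurable_fun setT (fun t => dot (F t) (G t)).
Proof.
by move=> mF mG; apply: measurable_mxM => //; exact: measurable_mx_tr.
Qed.

Lemma measurable_det n (F : T -> 'M[R]_n) :
  measurable_mx F -> measurable_fun setT (fun t => \det (F t)).
Proof.
move=> mF; apply: measurable_sum => s; apply: measurable_funM => //.
by apply: measurable_prod => i _.
Qed.

Lemma measurable_mx_adj n (F : T -> 'M[R]_n) :
  measurable_mx F -> measurable_mx (fun t => \adj (F t)).
Proof.
move=> mF i j; under eq_fun do rewrite mxE.
apply: measurable_funM => //; apply: measurable_det => k l.
by under eq_fun do rewrite !mxE; exact: mF.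
Qed.

Lemma measurable_mx_inv n (F : T -> 'M[R]_n) :
  measurable_mx F -> measurable_mx (fun t => invmx (F t)).
Proof.
move=> mF i j.
have md := measurable_det mF.
(* Cramer's formula; on a singular matrix [invmx] returns the matrix itself, hence the case
   distinction. *)
rewrite (_ : (fun t => _) = fun t =>
    if \det (F t) == 0 then F t i j
    else (\det (F t))^-1 * \adj (F t) i j); last first.
  apply/funext => t; rewrite /invmx unitmxE unitfE.
  by case: (\det (F t) == 0) => //=; rewrite mxE.
apply: measurable_fun_ifT; [exact: measurable_fun_eqr|exact: mF|].
apply: measurable_funM; last exact: measurable_mx_adj.
exact: (measurableT_comp measurable_inv).
Qed.

Lemma measurable_forall (I : finType) (f : I -> T -> bool) :
  (forall i, measurable_fun setT (f i)) ->
  measurable_fun setT (fun t => [forall i, f i t]).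
Proof.
move=> mf.
rewrite (_ : (fun t => _) = fun t => \big[andb/true]_i f i t); last first.
  by apply/funext => t; rewrite big_andE.
elim: (index_enum I) => [|i s IH].
  by under eq_fun do rewrite big_nil; exact: measurable_cst.
by under eq_fun do rewrite big_cons; exact: measurable_and.
Qed.

End measurable_mx.

(** * Measurability of positive definiteness and of the density of nu *)

Section schur_posdef.
Context {R : realType}.

(* A positive definiteness test by elimination of one variable at a time,     *)
(* visibly measurable in the entries, unlike the definition.                  *)
Fixpoint schur_posdef n : 'M[R]_n -> bool :=
  if n is n'.+1 then fun M : 'M[R]_(1 + n') =>
    (0 < M 0 0) && schur_posdef
      (drsubmx M - dlsubmx M *m invmx (ulsubmx M) *m ursubmx M)
  else fun=> true.

Lemma posdefmx_schurP n (M : 'M[R]_n) : M^T = M ->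
  posdefmx M <-> schur_posdef M.
Proof.
elim: n M => [|n IH] M MT.
  split=> // _; split=> // u; rewrite [u]flatmx0 eqxx//.
pose M' : 'M[R]_(1 + n) := M.
have MT' : M'^T = M' := MT.
have AT : (ulsubmx M')^T = ulsubmx M' by rewrite trmx_ulsub MT'.
have DT : (drsubmx M')^T = drsubmx M' by rewrite trmx_drsub MT'.
have CT : dlsubmx M' = (ursubmx M')^T by rewrite trmx_ursub MT'.
have ST : (drsubmx M' - dlsubmx M' *m invmx (ulsubmx M') *m ursubmx M')^T =
    drsubmx M' - dlsubmx M' *m invmx (ulsubmx M') *m ursubmx M'.
  by rewrite linearB/= DT !trmx_mul CT trmxK trmx_inv AT mulmxA.
have E : posdefmx M <-> posdefmx
    (block_mx (ulsubmx M') (ursubmx M') (ursubmx M')^T (drsubmx M')).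
  by rewrite -CT submxK.
rewrite E posdefmx_schur// -CT IH// /=.
have -> : posdefmx (ulsubmx M') <-> 0 < M' 0 0.
  have e : ulsubmx M' = diag_mx (\row_i M' 0 0).
    apply/matrixP => i j; rewrite !ord1 !mxE eqxx mulr1n.
    by congr (M' _ _); exact/val_inj.
  split => [/(posdefmx_diag_gt0 0)|M0]; first by rewrite e !mxE eqxx mulr1n.
  by rewrite e; apply: posdefmx_diag => i; rewrite mxE.
by split => [[-> ->]|/andP[]].
Qed.

Context {d : measure_display} {T : measurableType d}.

Lemma measurable_schur_posdef n (F : T -> 'M[R]_n) : measurable_mx F ->
  measurable_fun setT (fun t => schur_posdef (F t)).
Proof.
elim: n F => [|n IH] F mF; first exact: measurable_cst.
apply: measurable_and; first exact: measurable_fun_ltr.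
have mul : measurable_mx (fun t => @ulsubmx _ 1 n 1 n (F t)).
  by move=> i j; under eq_fun do rewrite !mxE; exact: mF.
have mur : measurable_mx (fun t => @ursubmx _ 1 n 1 n (F t)).
  by move=> i j; under eq_fun do rewrite !mxE; exact: mF.
have mdl : measurable_mx (fun t => @dlsubmx _ 1 n 1 n (F t)).
  by move=> i j; under eq_fun do rewrite !mxE; exact: mF.
have mdr : measurable_mx (fun t => @drsubmx _ 1 n 1 n (F t)).
  by move=> i j; under eq_fun do rewrite !mxE; exact: mF.
apply: IH; apply: measurable_mxD => //; apply: measurable_mxN.
apply: measurable_mxM => //; apply: measurable_mxM => //.
exact: measurable_mx_inv.
Qed.

Lemma measurable_posdefmx n (F : T -> 'M[R]_n) : measurable_mx F ->
  measurable_fun setT (fun t => `[< posdefmx (F t) >]).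
Proof.
move=> mF.
rewrite (_ : (fun t => _) = fun t =>
  [forall i, forall j, F t i j == F t j i] && schur_posdef (F t)); last first.
  apply/funext => t; apply/asboolP/idP => [pF|/andP[/'forall_forallP sF]].
    apply/andP; split; last by apply/posdefmx_schurP => //; exact: pF.1.
    by apply/'forall_forallP => i j; rewrite -{1}pF.1 mxE.
  apply posdefmx_schurP; apply/matrixP => i j.
  by rewrite mxE; exact/eqP.
apply: measurable_and; last exact: measurable_schur_posdef.
apply: measurable_forall => i; apply: measurable_forall => j.
exact: measurable_fun_eqr.
Qed.

Lemma measurable_Hmx n (W : T -> 'M[R]_n) (b : T -> n.-tuple R) :
  measurable_mx W -> measurable_fun setT b ->
  measurable_mx (fun t => Hmx (W t) (b t)).
Proof.
move=> mW mb; apply: measurable_mxD; last exact: measurable_mxN.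
apply: measurable_mx_diag => i j; under eq_fun do rewrite mxE.
apply: measurable_funM => //.
by have /measurable_fun_tnthP := mb; exact.
Qed.

Lemma measurable_nu_pdf n (W : T -> 'M[R]_n) (theta eta : T -> 'cV[R]_n)
    (b : T -> n.-tuple R) :
  measurable_mx W -> measurable_mx theta -> measurable_mx eta ->
  measurable_fun setT b ->
  measurable_fun setT (fun t => nu_pdf (W t) (theta t) (eta t) (b t)).
Proof.
move=> mW mth met mb.
have mH := measurable_Hmx mW mb.
apply: measurable_fun_ifT => //; first exact: measurable_posdefmx.
apply: measurable_funM.
  apply: measurable_funM; last by apply: measurable_prod => i _; exact: mth.
  apply: measurable_funM => //; apply: measurableT_comp => //.
  apply: measurable_funD; last exact: measurable_dot.
  apply: measurable_funB.
    apply: measurableT_comp => //; apply: measurable_funM => //.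
    by apply: measurable_dot => //; exact: measurable_mxM.
  apply: measurable_funM => //; apply: measurable_dot => //.
  by apply: measurable_mxM => //; exact: measurable_mx_inv.
apply: (measurableT_comp measurable_inv).
by apply: (measurableT_comp measurable_sqrt); exact: measurable_det.
Qed.

End schur_posdef.

(** * The change of variables *)

Section change_variables.
Context {R : realType} {n : nat}.
Local Notation lambda := (@lebesgue_tuple R).

(** [inv_A] and [inv_delta] express A = b^2/(a+b) and delta = beta - A/2 in terms of x = beta and y
    = alpha. *)
Definition inv_A (x y : n.-tuple R) : n.-tuple R :=
  [tuple (2 * tnth x i) ^+ 2 / (2 * tnth y i + 2 * tnth x i) | i < n].

Definition inv_delta (x y : n.-tuple R) : n.-tuple R :=
  [tuple tnth x i - tnth (inv_A x y) i / 2 | i < n].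

Definition inversion_jacobian (x y : n.-tuple R) : R :=
  \prod_i (2 * (2 * tnth x i) ^+ 2 / (2 * tnth y i + 2 * tnth x i) ^+ 2).

(** The shear u = x - v/2, at fixed v, has Jacobian 1. At fixed x the support condition on [h] then
    confines each v_i to ]0, 2 x_i[, which is the range of the inversion. *)
Lemma lebesgue_tuple_shear_inversion (h : n.-tuple R * n.-tuple R -> \bar R) :
  measurable_fun setT h -> (forall p, (0 <= h p)%E) ->
  (forall u v i, (tnth u i <= 0) || (tnth v i <= 0) -> h (u, v) = 0%E) ->
  (\int[lambda n]_u \int[lambda n]_v h (u, v) =
   \int[lambda n]_x \int[lambda n]_y (h (inv_delta x y, inv_A x y) *
     ((\prod_i (\1_`]0%R, +oo[ (tnth x i) * \1_`]0%R, +oo[ (tnth y i))) *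
       inversion_jacobian x y)%:E))%E.
Proof.
move=> mh h0 hs.
pose sh (x v : n.-tuple R) : n.-tuple R :=
  [tuple tnth x i - tnth v i / 2 | i < n].
have msh : measurable_fun setT (fun p : n.-tuple R * n.-tuple R => sh p.1 p.2).
  apply: measurable_mktuple => i; apply: measurable_funB.
    exact: measurable_fun_tnth.
  by apply: measurable_funM => //; exact: measurable_fun_tnth.
have mhsh : measurable_fun setT
    (fun p : n.-tuple R * n.-tuple R => h (sh p.1 p.2, p.2)).
  by apply: (measurableT_comp mh); exact: measurable_fun_pair.
transitivity (\int[lambda n]_v \int[lambda n]_u h (u, v))%E.
  exact: lebesgue_tuple_tonelli.
transitivity (\int[lambda n]_v \int[lambda n]_x h (sh x v, v))%E.
  apply: eq_integral => v _.
  have mhv : measurable_fun setT (fun u => h (u, v)).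
    exact: measurable_fun_pair1.
  have := @lebesgue_tuple_change_variables R n (fun i r => r - tnth v i / 2)
    (fun _ _ => 1) (fun _ _ => 1) (fun u => h (u, v)).
  under eq_integral do rewrite big1// mule1.
  under [X in _ -> _ -> _ -> _ -> _ -> _ -> _ -> _ -> _ = X]eq_integral
    do rewrite big1// mule1.
  apply => //.
  - by move=> i; exact: measurable_funB.
  - move=> i g mg g0.
    under eq_integral do rewrite mule1.
    under [RHS]eq_integral do rewrite mule1.
    exact: integral_translation.
transitivity (\int[lambda n]_x \int[lambda n]_v h (sh x v, v))%E.
  exact/esym/(lebesgue_tuple_tonelli mhsh).
apply: eq_integral => x _.
(* If some x_i <= 0, then v_i <= 0 or x_i - v_i/2 <= 0, so [h] vanishes; on the right the indicator
   does. *)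
have [/forallP x0|/forallPn[i]] := boolP [forall i, 0 < tnth x i]; last first.
  rewrite -leNgt => xi0.
  rewrite !integral0_eq// => v _.
    rewrite (bigD1 i)//= indicE memNset/= ?in_itv/= ?andbT ?ltNge ?xi0//.
    by rewrite !mul0r mule0.
  apply: (hs _ _ i); rewrite tnth_mktuple.
  by have [|] := leP (tnth v i) 0; [rewrite orbT|rewrite orbF; lra].
pose w i (r : R) : R := \1_`]0%R, (2 * tnth x i)[ r.
pose j i (r : R) : R := \1_`]0%R, +oo[ r *
  (2 * (2 * tnth x i) ^+ 2 / (2 * r + 2 * tnth x i) ^+ 2).
transitivity (\int[lambda n]_v (h (sh x v, v) * (\prod_i w i (tnth v i))%:E))%E.
  apply: eq_integral => v _.
  have [/forallP wv|/forallPn[i wv]] :=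
      boolP [forall i, tnth v i \in `]0%R, (2 * tnth x i)[].
    by rewrite big1 ?mule1// => i _; rewrite /w indicE mem_set//; exact: wv.
  (* Outside ]0, 2 x_i[ either v_i <= 0 or the sheared coordinate x_i - v_i/2 is nonpositive. *)
  rewrite (hs _ _ i) ?mul0e//; rewrite tnth_mktuple.
  move: wv; rewrite in_itv/= negb_and -!leNgt => /orP[->|].
    by rewrite orbT.
  by lra.
rewrite (@lebesgue_tuple_change_variables R n
  (fun i r => (2 * tnth x i) ^+ 2 / (2 * r + 2 * tnth x i)) w j
  (fun v => h (sh x v, v)))//.
- apply: eq_integral => y _; congr (h _ * _%:E)%E.
  rewrite /inversion_jacobian -big_split/=; apply: eq_bigr => i _.
  by rewrite /j [\1__ (tnth x i)]indicE mem_set/= ?in_itv/= ?andbT ?x0// mul1r.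
- move=> i; apply: measurable_funM => //; apply: (measurableT_comp measurable_inv).
  by apply: measurable_funD => //; exact: measurable_funM.
- by move=> i; exact: measurable_indic.
- move=> i; apply: measurable_funM; first exact: measurable_indic.
  apply: measurable_funM => //; apply: (measurableT_comp measurable_inv).
  by apply: measurable_funX; apply: measurable_funD => //; exact: measurable_funM.
- by move=> i r; rewrite /j mulr_ge0// divr_ge0 ?sqr_ge0// mulr_ge0// sqr_ge0.
- by move=> i g mg g0; apply: integral_inversion => //; rewrite mulr_gt0.
- exact: (measurable_fun_pair2 x mhsh).
Qed.

End change_variables.

(** * The joint densities *)

Section nu.
Context {R : realType} {n : nat}.
Implicit Types (W : 'M[R]_n) (theta eta z : 'cV[R]_n) (x y b : n.-tuple R).

Lemma nu_pdf_ge0 W theta eta b :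
  (forall i, 0 <= theta i 0) -> 0 <= nu_pdf W theta eta b.
Proof.
move=> t0; rewrite /nu_pdf; case: ifP => // _.
by rewrite divr_ge0 ?sqrtr_ge0// !mulr_ge0 ?powR_ge0 ?expR_ge0 ?prodr_ge0.
Qed.

Lemma ig_pdf_ge0 (m r t : R) : 0 <= ig_pdf m r t.
Proof.
by rewrite /ig_pdf; case: ifP => // _; rewrite mulr_ge0 ?sqrtr_ge0 ?expR_ge0.
Qed.

Lemma measurable_ig_pdf (m r : R) : measurable_fun setT (ig_pdf m r).
Proof.
apply: measurable_fun_ifT => //; first exact: measurable_fun_ltr.
apply: measurable_funM.
  apply: (measurableT_comp measurable_sqrt); apply: measurable_funM => //.
  apply: (measurableT_comp measurable_inv); apply: measurable_funM => //.
apply: measurableT_comp => //; apply: measurableT_comp => //.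
apply: measurable_funM; last first.
  by apply: (measurableT_comp measurable_inv); exact: measurable_funM.
by apply: measurable_funM => //; apply: measurable_funX; exact: measurable_funB.
Qed.

(** W~ = W + W G W, and the diagonal entries of W G W are values of the positive form [G] at the
    columns of [W]. Through [posdef_Hmx_gt0] this forces alpha > 0 on the support of its conditional
    law. *)
Lemma Wtilde_diag_ge0 W x i : W^T = W -> (forall j, 0 <= W j j) ->
  posdefmx (Hmx W x) -> 0 <= Wtilde W x i i.
Proof.
move=> WT W0 pH; have uH := posdefmx_unitmx pH.
have x0 j : 0 < tnth x j by exact: posdef_Hmx_gt0 pH.
set G := invmx (Hmx W x).
have -> : Wtilde W x = W + W *m G *m W.
  rewrite Wtilde_Hmx//; set B := diag_mx _.
  have BE : B = Hmx W x + W by rewrite /Hmx subrK.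
  have HB : G *m B = 1%:M + G *m W by rewrite BE mulmxDr mulVmx.
  rewrite -mulmxA HB BE mulmxDr mulmx1 mulmxDl [Hmx W x *m _]mulmxA mulmxV//.
  by rewrite mul1mx !mulmxA addrAC subrr add0r.
rewrite mxE addr_ge0// -dot_delta_mx -!mulmxA dot_trmx WT.
exact: posdefmx_inv_ge0.
Qed.

Lemma nu_pdf_Wtilde_eq0 W theta eta x y i : W^T = W -> (forall j, 0 <= W j j) ->
  posdefmx (Hmx W x) -> tnth y i <= 0 -> nu_pdf (Wtilde W x) theta eta y = 0.
Proof.
move=> WT W0 pH y0; rewrite /nu_pdf; case: asboolP => // pS.
have := posdef_Hmx_gt0 (Wtilde_diag_ge0 i WT W0 pH) pS.
by rewrite ltNge y0.
Qed.

End nu.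

Section joint_density.
Context {R : realType} {n : nat}.
Variables (W : 'M[R]_n) (theta eta z : 'cV[R]_n).
Hypotheses (WT : W^T = W) (W_ge0 : forall i, 0 <= W i i).
Hypotheses (theta_gt0 : forall i, 0 < theta i 0) (z_gt0 : forall i, 0 < z i 0).
Local Notation lambda := (@lebesgue_tuple R).

Definition beta_alpha_pdf (p : n.-tuple R * n.-tuple R) : R :=
  nu_pdf W theta (eta + \col_i (z i 0)^-1) p.1 *
  nu_pdf (Wtilde W p.1) (theta_tilde z p.1) (eta_tilde W eta p.1) p.2.

Definition delta_A_pdf (p : n.-tuple R * n.-tuple R) : R :=
  nu_pdf W theta eta p.1 *
  \prod_i ig_pdf (theta i 0 * z i 0)^-1 (z i 0 ^+ 2)^-1 (tnth p.2 i).

Lemma measurable_nu_pdf_tilde : measurable_fun setT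
  (fun p : n.-tuple R * n.-tuple R =>
     nu_pdf (Wtilde W p.1) (theta_tilde z p.1) (eta_tilde W eta p.1) p.2).
Proof.
have mx1 i :
    measurable_fun setT (fun p : n.-tuple R * n.-tuple R => tnth p.1 i).
  exact: measurable_fun_tnth.
apply: measurable_nu_pdf => //.
- apply: measurable_mxM; first exact: measurable_mx_cst.
  apply: measurable_mx_inv; apply: measurable_mxD; first exact: measurable_mx_cst.
  apply: measurable_mxN; apply: measurable_mxM; last exact: measurable_mx_cst.
  apply: measurable_mx_diag => i j; under eq_fun do rewrite mxE.
  by apply: (measurableT_comp measurable_inv); exact: measurable_funM.
- move=> i j; under eq_fun do rewrite mxE.
  apply: (measurableT_comp measurable_inv); apply: measurable_funM => //.
  exact: measurable_funM.
- apply: measurable_mxD; first exact: measurable_mx_cst.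
  apply: measurable_mxM; first exact: measurable_mx_cst.
  apply: measurable_mxM; last exact: measurable_mx_cst.
  apply: measurable_mx_inv; apply: measurable_Hmx => //.
Qed.

Lemma measurable_nu_pdf1 eta' : measurable_fun setT (nu_pdf W theta eta').
Proof. by apply: measurable_nu_pdf => //; exact: measurable_mx_cst. Qed.

Lemma measurable_beta_alpha_pdf : measurable_fun setT beta_alpha_pdf.
Proof.
apply: measurable_funM; last exact: measurable_nu_pdf_tilde.
exact: (measurableT_comp (measurable_nu_pdf1 _)).
Qed.

Lemma measurable_delta_A_pdf : measurable_fun setT delta_A_pdf.
Proof.
apply: measurable_funM; first exact: (measurableT_comp (measurable_nu_pdf1 _)).
apply: measurable_prod => i _; apply: (measurableT_comp (measurable_ig_pdf _ _)).
exact: measurable_fun_tnth.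
Qed.

Lemma nu_pdf_tilde_ge0 x y : posdefmx (Hmx W x) ->
  0 <= nu_pdf (Wtilde W x) (theta_tilde z x) (eta_tilde W eta x) y.
Proof.
move=> pH; apply: nu_pdf_ge0 => i; rewrite mxE invr_ge0 ltW// !mulr_gt0//.
exact: posdef_Hmx_gt0 pH.
Qed.

(** theta~ may have negative entries where H_beta is not positive definite, but there the first
    factor is 0. *)
Lemma beta_alpha_pdf_ge0 p : 0 <= beta_alpha_pdf p.
Proof.
rewrite /beta_alpha_pdf; have [pH|npH] := pselect (posdefmx (Hmx W p.1)).
  by rewrite mulr_ge0 ?nu_pdf_tilde_ge0// nu_pdf_ge0// => i; exact: ltW.
by rewrite {1}/nu_pdf asboolF// mul0r.
Qed.

Lemma delta_A_pdf_ge0 p : 0 <= delta_A_pdf p.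
Proof.
rewrite mulr_ge0 ?nu_pdf_ge0// => [i|]; first exact: ltW.
by rewrite prodr_ge0// => i _; exact: ig_pdf_ge0.
Qed.

Lemma delta_A_pdf_eq0 u v i :
  (tnth u i <= 0) || (tnth v i <= 0) -> delta_A_pdf (u, v) = 0.
Proof.
rewrite /delta_A_pdf/= => /orP[u0|v0].
  rewrite /nu_pdf; case: asboolP => [pH|]; last by rewrite mul0r.
  by have := posdef_Hmx_gt0 (W_ge0 i) pH; rewrite ltNge u0.
by rewrite (bigD1 i)//= /ig_pdf ltNge v0/= mul0r mulr0.
Qed.

(** On the positive orthant this is [nu_pdf_delta]. Elsewhere an indicator kills the left side, and
    on the right H_beta or S fails to be positive definite. *)
Lemma delta_A_pdf_inv x y :
  delta_A_pdf (inv_delta x y, inv_A x y) *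
    ((\prod_i (\1_`]0%R, +oo[ (tnth x i) * \1_`]0%R, +oo[ (tnth y i))) *
      inversion_jacobian x y) = beta_alpha_pdf (x, y).
Proof.
have [/forallP x0|/forallPn[i]] := boolP [forall i, 0 < tnth x i]; last first.
  rewrite -leNgt => x0; rewrite (bigD1 i)//= indicE.
  rewrite memNset/= ?in_itv/= ?andbT ?ltNge ?x0//.
  rewrite !mul0r mulr0 /beta_alpha_pdf/= {1}/nu_pdf.
  case: asboolP => [pH|]; last by rewrite mul0r.
  by have := posdef_Hmx_gt0 (W_ge0 i) pH; rewrite ltNge x0.
have [/forallP y0|/forallPn[i]] := boolP [forall i, 0 < tnth y i]; last first.
  rewrite -leNgt => y0; rewrite (bigD1 i)//= [\1__ (tnth y i)]indicE.
  rewrite memNset/= ?in_itv/= ?andbT ?ltNge ?y0//.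
  rewrite mulr0 !mul0r mulr0 /beta_alpha_pdf/=.
  have [pH|npH] := pselect (posdefmx (Hmx W x)).
    by rewrite (nu_pdf_Wtilde_eq0 _ _ WT W_ge0 pH y0) mulr0.
  by rewrite {1}/nu_pdf asboolF// mul0r.
rewrite big1 ?mul1r; last first.
  by move=> i _; rewrite !indicE !mem_set ?mul1r//= in_itv/= andbT.
rewrite /beta_alpha_pdf/= -(nu_pdf_delta WT x0 y0 eta theta_gt0 z_gt0).
rewrite /delta_A_pdf/= -mulrA; congr (nu_pdf _ _ _ _ * (_ * _)).
- by apply/eq_from_tnth => i; rewrite !tnth_mktuple.
- by apply: eq_bigr => i _; rewrite tnth_mktuple.
Qed.

End joint_density.

(** * Joint laws of (beta, alpha) and (delta, A) *)

Lemma integral_law_density {R : realType} d (T : measurableType d)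
    (P : probability T R) n (X : {RV P >-> n.-tuple R}) (f : n.-tuple R -> R)
    (h : n.-tuple R -> \bar R) :
  has_law P X (fun A => \int[lebesgue_tuple n]_(x in A) (f x)%:E)%E ->
  measurable_fun setT f -> (forall x, 0 <= f x) ->
  measurable_fun setT h -> (forall x, (0 <= h x)%E) ->
  (\int[P]_w h (X w) = \int[lebesgue_tuple n]_x (h x * (f x)%:E))%E.
Proof.
move=> lX mf f0 mh h0.
have := @eq_integral_comp _ _ _ _ _ _ R P (lebesgue_tuple n) X id (fun=> 1) f h.
under eq_integral do rewrite mule1.
apply => // A mA.
under eq_integral do rewrite mulr1.
rewrite integral_indicM -(lX A mA) (integral_indic _ measurableT)//= ?setIT//.
by rewrite -[X in measurable X]setTI; exact: measurable_funPT.
Qed.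

Section laws.
Context {R : realType} {n : nat}.
Variables (W : 'M[R]_n) (theta eta z : 'cV[R]_n).
Hypotheses (WT : W^T = W) (W_ge0 : forall i, 0 <= W i i).
Hypotheses (theta_gt0 : forall i, 0 < theta i 0) (z_gt0 : forall i, 0 < z i 0).
Local Notation lambda := (@lebesgue_tuple R).

(** The conditional law makes the left side an expectation of a function of beta, which the density
    of beta turns into a Lebesgue integral. *)
Lemma beta_alpha_law d (T : measurableType d) (P : probability T R)
    (beta alpha : {RV P >-> n.-tuple R}) :
  has_law P beta (nu W theta (eta + \col_i (z i 0)^-1)) ->
  has_cond_law P beta alpha
    (fun b => nu (Wtilde W b) (theta_tilde z b) (eta_tilde W eta b)) ->
  forall A B, measurable A -> measurable B ->
    (P (beta @^-1` A `&` alpha @^-1` B) =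
     \int[lambda n]_(x in A) \int[lambda n]_(y in B)
       (beta_alpha_pdf W theta eta z (x, y))%:E)%E.
Proof.
move=> lbeta calpha A B mA mB; rewrite calpha//.
pose g x y := nu_pdf (Wtilde W x) (theta_tilde z x) (eta_tilde W eta x) y.
have mg : measurable_fun setT
    (fun p : n.-tuple R * n.-tuple R => (g p.1 p.2)%:E).
  by apply/measurable_EFinP; exact: measurable_nu_pdf_tilde.
have mbetaA : measurable (beta @^-1` A).
  by rewrite -[X in measurable X]setTI; exact: measurable_funPT.
have meas_int (k : n.-tuple R * n.-tuple R -> \bar R) : measurable_fun setT k ->
    (forall p, (0 <= k p)%E) ->
    measurable_fun setT (fun x => \int[lambda n]_(y in B) k (x, y))%E.
  move=> mk k0; under eq_fun do rewrite integral_mkcond.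
  rewrite (_ : (fun x => _) = fun x =>
    (\int[lambda n]_y ((\1_B y)%:E * k (x, y)))%E); last first.
    apply/funext => x; apply: eq_integral => y _; rewrite patchE indicE.
    by case: ifPn => _; rewrite ?mul1e ?mul0e.
  apply: (@measurable_lebesgue_tuple_integral R _ _ n
    (fun p => (\1_B p.2)%:E * k p)%E).
    apply: emeasurable_funM => //; apply/measurable_EFinP.
    apply: (@measurableT_comp _ _ _ _ _ _ (\1_B : n.-tuple R -> R)) => //.
  by move=> p; rewrite mule_ge0// lee_fin.
(* Where H_beta is not positive definite, theta_tilde and hence g can be       *)
(* negative; this happens with probability 0, so g may be replaced by `|g|.    *)
pose kappa x := (\int[lambda n]_(y in B) `|(g x y)%:E|)%E.
have mkappa : measurable_fun setT kappa.
  apply: (meas_int (fun p => `|(g p.1 p.2)%:E|%E)) => //.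
  exact: measurableT_comp.
have kappa0 x : (0 <= kappa x)%E by exact: integral_ge0.
have mnu : measurable_fun setT
    (fun b => nu (Wtilde W b) (theta_tilde z b) (eta_tilde W eta b) B).
  (* The integrand can be negative, so measurability goes through its positive and negative parts,
     each covered by [meas_int]. *)
  rewrite (_ : (fun b => _) = fun b =>
    (\int[lambda n]_(y in B) (fun p => (g p.1 p.2)%:E)^\+ (b, y)
     - \int[lambda n]_(y in B) (fun p => (g p.1 p.2)%:E)^\- (b, y))%E);
    last first.
    apply/funext => b; rewrite /nu [LHS]integralE.
    by congr (_ - _)%E; apply: eq_integral => y _; rewrite ?funeposE ?funenegE.
  apply: emeasurable_funB; apply: meas_int => //.
    exact: measurable_funepos.
  exact: measurable_funeneg.
pose f := nu_pdf W theta (eta + \col_i (z i 0)^-1).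
have mf : measurable_fun setT f by exact: measurable_nu_pdf1.
have f0 x : 0 <= f x by apply: nu_pdf_ge0 => i; exact: ltW.
transitivity (\int[P]_(w in beta @^-1` A) kappa (beta w))%E.
  apply: (@ae_eq_integral _ T R P (beta @^-1` A) (fun w => kappa (beta w))
    (fun w => nu (Wtilde W (beta w)) (theta_tilde z (beta w))
      (eta_tilde W eta (beta w)) B) mbetaA).
  - by apply: measurable_funTS; exact: (measurableT_comp mnu).
  - by apply: measurable_funTS; exact: (measurableT_comp mkappa).
  - pose D := [set x : n.-tuple R | posdefmx (Hmx W x)].
    have mD : measurable D.
      rewrite (_ : D = (fun x => `[< posdefmx (Hmx W x) >]) @^-1` [set true]).
        rewrite -[X in measurable X]setTI; apply: measurable_posdefmx => //.
        by apply: measurable_Hmx => //; exact: measurable_mx_cst.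
      by apply/seteqP; split => x /asboolP.
    exists (beta @^-1` (~` D)); split.
    + rewrite -[X in measurable X]setTI; apply: measurable_funPT => //.
      exact: measurableC.
    + rewrite -[LHS]/(distribution P beta (~` D)) lbeta; last exact: measurableC.
      by apply: integral0_eq => x nDx; rewrite /nu_pdf asboolF.
    + move=> w /= nw Dw; apply: nw => _.
      apply: eq_integral => y _; rewrite gee0_abs// lee_fin.
      exact: nu_pdf_tilde_ge0.
rewrite integral_mkcond.
transitivity (\int[P]_w ((\1_A (beta w))%:E * kappa (beta w)))%E.
  apply: eq_integral => w _; rewrite patchE indicE.
  rewrite (_ : (w \in beta @^-1` A) = (beta w \in A))//.
  by case: ifPn => _; rewrite ?mul1e ?mul0e.
rewrite (integral_law_density (h := fun x => (\1_A x)%:E * kappa x)%E lbeta)//;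
  last 2 first.
- apply: emeasurable_funM => //; apply/measurable_EFinP.
  exact: measurable_indic.
- by move=> x; rewrite mule_ge0// lee_fin.
rewrite [RHS]integral_mkcond; apply: eq_integral => x _; rewrite patchE indicE.
case: ifPn => xA; rewrite ?mul0e// mul1e.
rewrite /kappa -ge0_integralZr; last 4 first.
- exact: mB.
- apply: measurable_funTS; apply: measurableT_comp; first exact: abse_measurable.
  exact: (measurable_fun_pair2 x mg).
- by move=> y _; exact: abse_ge0.
- by rewrite lee_fin.
apply: eq_integral => y _; rewrite -EFinM; congr EFin.
rewrite /beta_alpha_pdf/= -/(f x) -/(g x y) mulrC.
(* The absolute value in [kappa] disappears: either [g x y] is nonnegative, or [f x] is 0. *)
have [pH|npH] := pselect (posdefmx (Hmx W x)).
  by rewrite ger0_norm//; exact: nu_pdf_tilde_ge0.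
by rewrite /f /nu_pdf asboolF// !mul0r.
Qed.

(** Independence makes the probability a product of two integrals, and each factor is moved inside
    the other integral. *)
Lemma delta_A_law d (T : measurableType d) (Q : probability T R)
    (delta : {RV Q >-> n.-tuple R}) (A : 'I_n -> {RV Q >-> R}) :
  has_law Q delta (nu W theta eta) ->
  (forall i, has_law Q (A i) (ig (theta i 0 * z i 0)^-1 (z i 0 ^+ 2)^-1)) ->
  mutually_independent Q A ->
  independent Q delta (fun w => [tuple A i w | i < n]) ->
  forall B C, measurable B -> measurable C ->
    (Q (delta @^-1` B `&` (fun w => [tuple A i w | i < n]) @^-1` C) =
     \int[lambda n]_(u in B) \int[lambda n]_(v in C)
       (delta_A_pdf W theta eta z (u, v))%:E)%E.
Proof.
move=> ldelta lA indA indep B C mB mC; rewrite indep//.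
rewrite (independent_tuple_density _ _ lA)//; last 2 first.
- by move=> i; exact: measurable_ig_pdf.
- by move=> i x; exact: ig_pdf_ge0.
rewrite -[Q (delta @^-1` B)]/(distribution Q delta B) ldelta//.
have mp : measurable_fun setT (fun v : n.-tuple R => \prod_i
    ig_pdf (theta i 0 * z i 0)^-1 (z i 0 ^+ 2)^-1 (tnth v i)).
  apply: (measurable_prod_tnth
    (v := fun i => ig_pdf (theta i 0 * z i 0)^-1 (z i 0 ^+ 2)^-1)) => i.
  exact: measurable_ig_pdf.
have p0 (v : n.-tuple R) : 0 <= \prod_i
    ig_pdf (theta i 0 * z i 0)^-1 (z i 0 ^+ 2)^-1 (tnth v i).
  by apply: prodr_ge0 => i _; exact: ig_pdf_ge0.
rewrite /nu -ge0_integralZr//; last 3 first.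
- by apply: measurable_funTS; apply/measurable_EFinP; exact: measurable_nu_pdf1.
- by move=> u _; rewrite lee_fin nu_pdf_ge0// => i; exact: ltW.
- by apply: integral_ge0 => v _; rewrite lee_fin.
apply: eq_integral => u _; rewrite -ge0_integralZl//; last 3 first.
- by apply: measurable_funTS; exact/measurable_EFinP.
- by move=> v _; rewrite lee_fin.
- by rewrite lee_fin nu_pdf_ge0// => i; exact: ltW.
Qed.

End laws.

(** * Equality of the two laws *)

Theorem theorem2p5 (R : realType) (n : nat)
    (E : {set {set 'I_n}}) (c : {set 'I_n} -> R)
    (E_connected : connected_graph E) (c_gt0 : forall e, e \in E -> 0 < c e)
    (theta eta z : 'cV[R]_n)
    (theta_gt0 : forall i, 0 < theta i 0) (eta_ge0 : forall i, 0 <= eta i 0)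
    (z_gt0 : forall i, 0 < z i 0)
    (d : measure_display) (T : measurableType d) (P : probability T R)
    (beta alpha : {RV P >-> n.-tuple R})
    (d' : measure_display) (T' : measurableType d') (Q : probability T' R)
    (delta : {RV Q >-> n.-tuple R}) (A : 'I_n -> {RV Q >-> R}) :
  let W := conductance_mx E c in
  has_law P beta (nu W theta (eta + \col_i (z i 0)^-1)) ->
  has_cond_law P beta alpha
    (fun b => nu (Wtilde W b) (theta_tilde z b) (eta_tilde W eta b)) ->
  has_law Q delta (nu W theta eta) ->
  (forall i, has_law Q (A i) (ig (theta i 0 * z i 0)^-1 (z i 0 ^+ 2)^-1)) ->
  mutually_independent Q A ->
  independent Q delta (fun w => [tuple A i w | i < n]) ->
  eq_in_law P Q
    (fun w => ([tuple 2 * tnth (beta w) i | i < n],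
               [tuple (2 * tnth (beta w) i) ^+ 2 / (2 * tnth (alpha w) i)
                  | i < n]))
    (fun w => ([tuple 2 * tnth (delta w) i + A i w | i < n],
               [tuple A i w + A i w ^+ 2 / (2 * tnth (delta w) i) | i < n])).
Proof.
move=> W.
have WT : W^T = W.
  by apply/matrixP => i j; rewrite !mxE finset.setUC.
have W_ge0 i : 0 <= W i i.
  by rewrite mxE; case: ifP => // /c_gt0/ltW.
move: W WT W_ge0 => W WT W_ge0 lbeta calpha ldelta lA indA indep C mC.
have mA : measurable_fun setT (fun w => [tuple A i w | i < n]).
  by apply: measurable_mktuple => i; exact: measurable_funPT.
pose PhiL (p : n.-tuple R * n.-tuple R) :=
  ([tuple 2 * tnth p.1 i | i < n],
   [tuple (2 * tnth p.1 i) ^+ 2 / (2 * tnth p.2 i) | i < n]).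
pose PhiR (p : n.-tuple R * n.-tuple R) :=
  ([tuple 2 * tnth p.1 i + tnth p.2 i | i < n],
   [tuple tnth p.2 i + tnth p.2 i ^+ 2 / (2 * tnth p.1 i) | i < n]).
have m1 i : measurable_fun setT (fun p : n.-tuple R * n.-tuple R => tnth p.1 i).
  exact: measurable_fun_tnth.
have m2 i : measurable_fun setT (fun p : n.-tuple R * n.-tuple R => tnth p.2 i).
  exact: measurable_fun_tnth.
have mPhiL : measurable_fun setT PhiL.
  apply: measurable_fun_pair; apply: measurable_mktuple => i.
    exact: measurable_funM.
  apply: measurable_funM; first by apply: measurable_funX; exact: measurable_funM.
  by apply: (measurableT_comp measurable_inv); exact: measurable_funM.
have mPhiR : measurable_fun setT PhiR.
  apply: measurable_fun_pair; apply: measurable_mktuple => i.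
    by apply: measurable_funD => //; exact: measurable_funM.
  apply: measurable_funD => //; apply: measurable_funM; first exact: measurable_funX.
  by apply: (measurableT_comp measurable_inv); exact: measurable_funM.
have mPL : measurable (PhiL @^-1` C).
  by rewrite -[X in measurable X]setTI; exact: mPhiL.
have mPR : measurable (PhiR @^-1` C).
  by rewrite -[X in measurable X]setTI; exact: mPhiR.
rewrite /pushforward.
transitivity (P ((fun w => (beta w, alpha w)) @^-1` (PhiL @^-1` C))).
  by [].
transitivity (Q ((fun w => (delta w, [tuple A i w | i < n])) @^-1`
    (PhiR @^-1` C))); last first.
  congr (Q _); apply/funext => w /=; congr (C (_, _));
    by apply/eq_from_tnth => i; rewrite !tnth_mktuple.
rewrite (pair_density _ _ (measurable_beta_alpha_pdf W theta eta z)
  (beta_alpha_pdf_ge0 eta W_ge0 theta_gt0 z_gt0)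
  (beta_alpha_law W_ge0 theta_gt0 z_gt0 lbeta calpha) mPL); last 2 first.
- exact: measurable_funPT.
- exact: measurable_funPT.
rewrite (pair_density (measurable_funPT delta) mA
  (measurable_delta_A_pdf W theta eta z) (delta_A_pdf_ge0 W eta z theta_gt0)
  (delta_A_law theta_gt0 ldelta lA indA indep) mPR).
pose h (p : n.-tuple R * n.-tuple R) :=
  (\1_(PhiR @^-1` C) p * delta_A_pdf W theta eta z p)%:E.
rewrite (lebesgue_tuple_shear_inversion (h := h)).
- apply: eq_integral => x _; apply: eq_integral => y _.
  rewrite /h -EFinM -mulrA delta_A_pdf_inv//; congr EFin.
  (* Positivity of x and y makes the divisions in [PhiL] and [PhiR] legitimate; at every other point
     [beta_alpha_pdf] is 0 and the indicators of [C] do not matter. *)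
  have [/forallP xy|/forallPn[i xy]] :=
      boolP [forall i, (0 < tnth x i) && (0 < tnth y i)]; last first.
    rewrite -(delta_A_pdf_inv eta WT W_ge0 theta_gt0 z_gt0) (bigD1 i)//=.
    rewrite (_ : \1__ (tnth x i) * \1__ (tnth y i) = 0) ?mul0r ?mulr0//.
    have ind0 (r : R) : r <= 0 -> \1_`]0%R, +oo[ r = 0 :> R.
      by move=> r0; rewrite indicE memNset//= in_itv/= andbT ltNge r0.
    by move: xy; rewrite negb_and -!leNgt => /orP[] /ind0 ->;
      rewrite ?mul0r ?mulr0.
  congr (_ * _); suff E1 : PhiR (inv_delta x y, inv_A x y) = PhiL (x, y).
    by rewrite -[RHS]/(\1_C (PhiR (inv_delta x y, inv_A x y))) E1.
  rewrite /PhiR /PhiL/=; congr (_, _); apply/eq_from_tnth => i;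
    have /andP[xi yi] := xy i; rewrite !tnth_mktuple;
    move: (tnth x i) (tnth y i) xi yi => r s r0 s0.
    by field; rewrite gt_eqF// addr_gt0// mulr_gt0.
  field; rewrite (gt_eqF s0) gt_eqF ?addr_gt0 ?mulr_gt0//=.
  (* With b = 2r and a = 2s this is ab, the numerator of 2 delta = ab/(a+b), by which the second
     component of [PhiR] divides. *)
  rewrite (_ : _ - _ = 4 * r * s); last by ring.
  by rewrite gt_eqF// !mulr_gt0.
- apply/measurable_EFinP/measurable_funM; last exact: measurable_delta_A_pdf.
  exact: measurable_indic.
- by move=> p; rewrite lee_fin mulr_ge0// delta_A_pdf_ge0.
- by move=> u v i uv; rewrite /h (delta_A_pdf_eq0 theta eta z W_ge0 uv) mulr0.
Qed.
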